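(* For every $n$, the number $\mathcal{A}'_n$ of cyclically symmetric plane partitions in the $n$-cube is $$\mathcal{A}'_n=3^{-\binom n2}H_n(\hat C_1).$$
   Context: A plane partition in the $n$-cube is identified with its three-dimensional Ferrers diagram, a subset $\pi\subseteq\{1,\dots,n\}^3$ such that $(i',j',k')\in\pi$ whenever $(i,j,k)\in\pi$ and $1\le i'\le i$, $1\le j'\le j$, $1\le k'\le k$; it is cyclically symmetric if $(i,j,k)\in\pi$ implies $(j,k,i)\in\pi$. The formal power series $\hat C_1$ is $$\hat C_1(x)=\frac{1-(1-9x)^{2/3}}{3x}.$$ For a formal power series $A(x)=\sum_{k\ge0}A_kx^k$, $H_n(A)=\det(A_{i+j})_{0\le i,j\le n-1}$. *)

(* Defs.v *)
From mathcomp Require Import all_boot all_order all_algebra.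

Set Implicit Arguments.
Unset Strict Implicit.
Unset Printing Implicit Defensive.

Import GRing.Theory.
Local Open Scope ring_scope.

(* The cube {1,...,n}^3, with every coordinate shifted down by one. *)
Definition cube (n : nat) : finType := ('I_n * 'I_n * 'I_n)%type.

Definition plane_partition (n : nat) (pi : {set cube n}) : bool :=
  [forall i : 'I_n, forall j : 'I_n, forall k : 'I_n,
   forall i' : 'I_n, forall j' : 'I_n, forall k' : 'I_n,
     [&& (i, j, k) \in pi, (i' <= i)%N, (j' <= j)%N & (k' <= k)%N]
       ==> ((i', j', k') \in pi)].

Definition cyclically_symmetric (n : nat) (pi : {set cube n}) : bool :=
  [forall i : 'I_n, forall j : 'I_n, forall k : 'I_n,
     ((i, j, k) \in pi) ==> ((j, k, i) \in pi)].

Definition cspp (n : nat) : {set {set cube n}} :=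
  [set pi | plane_partition pi && cyclically_symmetric pi].

(* A formal power series is its sequence of coefficients; [A k] is the
   coefficient of x^k. *)
Definition fps : Type := nat -> rat.

Definition fps_one : fps := fun k => (k == 0%N)%:R.

Definition fps_sub (A B : fps) : fps := fun k => A k - B k.

Definition fps_scale (c : rat) (A : fps) : fps := fun k => c * A k.

Definition fps_mulX (A : fps) : fps := fun k => if k is k'.+1 then A k' else 0.

(* Division by x; meaningful when the constant coefficient vanishes. *)
Definition fps_divX (A : fps) : fps := fun k => A k.+1.

Definition gbinom (a : rat) (k : nat) : rat :=
  (\prod_(i < k) (a - i%:R)) / k`!%:R.

(* (1 + c x)^a as the binomial series. *)
Definition fps_binomial (c a : rat) : fps := fun k => gbinom a k * c ^+ k.

Definition hatC1 : fps :=
  fps_divX (fps_scale 3^-1 (fps_sub fps_one (fps_binomial (- 9) (2 / 3)))).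

(* The division by 3x in [hatC1] is exact. *)
Lemma hatC1_spec :
  fps_scale 3 (fps_mulX hatC1)
    =1 fps_sub fps_one (fps_binomial (- 9) (2 / 3)).
Proof.
case=> [|k].
  by rewrite /fps_scale /fps_sub /fps_binomial /gbinom /= big_ord0 mulr0.
by rewrite /fps_scale /= /hatC1 /fps_divX /fps_scale mulVKf.
Qed.

Definition hankel (n : nat) (A : fps) : rat := \det (\matrix_(i < n, j < n) A (i + j)%N).

(* Main.v *)
Require Import Defs.
From HB Require Import structures.
From mathcomp Require Import all_boot all_order all_algebra all_field.
From mathcomp Require Import perm boolp ring zify.

Set Implicit Arguments.
Unset Strict Implicit.
Unset Printing Implicit Defensive.

Import GRing.Theory Num.Theory.
Local Open Scope ring_scope.

(** Cyclically symmetric plane partitions and a Hankel determinant meet in the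
    determinant of [delta_ij + binomial (i + j) i].

    _Counting._  Cut the cube along its cyclic symmetry and record, for each
    level [k] and each distance [d], how far the partition extends along the
    two diagonals [(k + r, k + r + d, k)] and [(k + r + d, k + r, k)].  For
    fixed [d] this gives two strict partitions; when [d] grows by one, each
    part drops by 0 or 1, both strict partitions always have the same number
    of parts, they coincide for [d = 0] and are empty for [d = n].  The
    partitions in the [n]-cube are exactly these chains ([card_cspp]).

    The number of chains of [d] steps from a pair [(f, g)] to the empty pair is
    a determinant ([card_chains]): with
    [gram d a b = \sum_(i < d) binomial i (a - 1) * binomial i (b - 1)],
    Pascal's rule writes each entry [gram d.+1 (f i) (g j)], corrected by 1 on
    the diagonal where both parts vanish, as the sum of the entries of the next
    level over the possible successors of [f i] and [g j]; expanding the
    determinant in rows and columns produces all pairs of successors, and those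
    which are not strict partitions give two equal rows or columns.  Pairs of
    different lengths give a zero row or column.  Summing over the starting pairs [(f, f)] adds up all principal minors of the matrix of
    [gram n], which gives [\det (1 + U^T U) = \det (1 + U U^T)] where [U] is
    Pascal's triangle, and [U U^T] has the entries [binomial (i + j) i] by
    Vandermonde's identity ([sum_link_strict], [det_gram_pascal]).

    _Hankel determinant._  Let [m_k] be the coefficient of order [k] of
    [hatC1 (x / 3)], let [L] be the linear form on polynomials sending ['X^k] to
    [m_k], and let [b] be a primitive sixth root of unity, so that
    [b ^+ 2 = b - 1] and [1 - b] is the other one.  The substitution
    [x = (1 - 2 b) s (1 - s) / (1 - b s) ^+ 3] makes [1 - 3 x] the cube of
    [(1 - (1 - b) s) / (1 - b s)], hence rationalizes the generating series of
    the [m_k].  Accordingly one defines polynomials [biorth b i] of degree [i]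
    with leading coefficient [(1 - 2 b) ^+ i] by
    [\sum_i biorth b i s ^+ i
       = (1 - b s) ^+ 2 / ((1 - b s) ^+ 3 - (1 - 2 b) s (1 - s) 'X)],
    and then [L (biorth b i * biorth (1 - b) j) = delta_ij + binomial (i + j) i]
    ([biorthogonal]).  So the matrix of [delta_ij + binomial (i + j) i] is the
    Hankel matrix of the [m_k] multiplied by two triangular matrices whose
    determinants have the product
    [((1 - 2 b) * (1 - 2 (1 - b))) ^+ 'C(n, 2) = 3 ^+ 'C(n, 2)]
    ([hankel_hatC1]); the rescaling of [x] by 3 turns this factor into
    [3 ^- 'C(n, 2)]. *)

(** * Formal power series *)

(** A record rather than a function type, so that the convolution product does
    not compete with pointwise operations. *)
Record series (R : Type) := Series { scoef :> nat -> R }.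

Lemma seriesP (R : Type) (a b : series R) : a =1 b -> a = b.
Proof. by case: a b => f [g] /= /funext ->. Qed.

HB.instance Definition _ (R : Type) := gen_eqMixin (series R).
HB.instance Definition _ (R : Type) := gen_choiceMixin (series R).

Section SeriesZmod.
Variable V : zmodType.

Definition series_zero : series V := Series (fun _ => 0).
Definition series_opp (a : series V) := Series (fun n => - a n).
Definition series_add (a b : series V) := Series (fun n => a n + b n).

Fact series_addA : associative series_add.
Proof. by move=> a b c; apply/seriesP => n /=; rewrite addrA. Qed.
Fact series_addC : commutative series_add.
Proof. by move=> a b; apply/seriesP => n /=; rewrite addrC. Qed.
Fact series_add0 : left_id series_zero series_add.
Proof. by move=> a; apply/seriesP => n /=; rewrite add0r. Qed.
Fact series_addN : left_inverse series_zero series_opp series_add.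
Proof. by move=> a; apply/seriesP => n /=; rewrite addNr. Qed.

HB.instance Definition _ :=
  GRing.isZmodule.Build (series V) series_addA series_addC series_add0
    series_addN.

Lemma scoefD (a b : series V) n : (a + b) n = a n + b n. Proof. by []. Qed.
Lemma scoefN (a : series V) n : (- a) n = - a n. Proof. by []. Qed.
Lemma scoefB (a b : series V) n : (a - b) n = a n - b n. Proof. by []. Qed.
Lemma scoef0 n : (0 : series V) n = 0. Proof. by []. Qed.

End SeriesZmod.

Section SeriesRing.
Variable R : comNzRingType.
Implicit Types a b c : series R.

Definition series_mul a b : series R :=
  Series (fun n => \sum_(i < n.+1) a i * b (n - i)%N).
Definition series_const (k : R) : series R :=
  Series (fun n => if n == 0%N then k else 0).
Definition series_var : series R := Series (fun n => (n == 1%N)%:R).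

(** The coefficient of order [n] of a product only depends on the factors up to
    order [n], so the ring laws of series follow from those of polynomials. *)
Lemma series_mul_poly n a b (p q : {poly R}) :
  (forall i, (i <= n)%N -> p`_i = a i) -> (forall i, (i <= n)%N -> q`_i = b i) ->
  (p * q)`_n = series_mul a b n.
Proof.
move=> pa qb; rewrite coefM; apply: eq_bigr => i _.
by rewrite pa ?qb ?leq_subr // -ltnS.
Qed.

Let trunc n a := \poly_(i < n.+1) a i.
Let truncE n a i : (i <= n)%N -> (trunc n a)`_i = a i.
Proof. by rewrite coef_poly ltnS => ->. Qed.
Let truncM n a b i : (i <= n)%N -> (trunc n a * trunc n b)`_i = series_mul a b i.
Proof.
by move=> le_in; apply: series_mul_poly => j le_ji;
  apply: truncE (leq_trans le_ji le_in).
Qed.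

Fact series_mulA : associative series_mul.
Proof.
move=> a b c; apply/seriesP => n.
rewrite -(@series_mul_poly n _ _ (trunc n a) (trunc n b * trunc n c)).
- rewrite mulrA (@series_mul_poly n (series_mul a b) c) // => i le_in.
    exact: truncM.
  exact: truncE.
- by move=> i; apply: truncE.
- by move=> i; apply: truncM.
Qed.
Fact series_mulC : commutative series_mul.
Proof. by move=> a b; apply/seriesP => n; rewrite -!(@truncM n) // mulrC. Qed.
Fact series_mul1 : left_id (series_const 1) series_mul.
Proof.
move=> a; apply/seriesP => n.
rewrite -(@series_mul_poly n _ _ 1 (trunc n a)) ?mul1r ?truncE //.
  by move=> i _; rewrite coef1 /=; case: eqP.
by move=> i; apply: truncE.
Qed.
Fact series_mulDl : left_distributive series_mul +%R.
Proof.
move=> a b c; apply/seriesP => n.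
by rewrite /= -big_split /=; apply: eq_bigr => i _; rewrite -mulrDl.
Qed.
Fact series_neq0 : series_const 1 != 0.
Proof.
by apply/eqP => /(congr1 (fun a : series R => a 0%N))/eqP; rewrite oner_eq0.
Qed.

HB.instance Definition _ :=
  GRing.Zmodule_isComNzRing.Build (series R) series_mulA series_mulC
    series_mul1 series_mulDl series_neq0.

Lemma scoefM a b n : (a * b) n = \sum_(i < n.+1) a i * b (n - i)%N.
Proof. by []. Qed.

Lemma scoef_constM k a n : (series_const k * a) n = k * a n.
Proof.
rewrite scoefM big_ord_recl /= subn0 big1 ?addr0 // => i _.
by rewrite mul0r.
Qed.

Lemma scoef_varM a n : (series_var * a) n = if n is m.+1 then a m else 0.
Proof.
rewrite scoefM big_ord_recl mul0r add0r; case: n => [|n]; first by rewrite big_ord0.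
rewrite big_ord_recl /= mul1r subn1 big1 ?addr0 // => i _.
by rewrite mul0r.
Qed.

Lemma scoef_varX j n : (series_var ^+ j) n = (n == j)%:R.
Proof.
elim: j n => [|j IHj] [|n] //; rewrite exprS scoef_varM ?IHj //.
Qed.

Fact series_const_zmod : zmod_morphism series_const.
Proof.
by move=> x y; apply/seriesP => -[|n]; rewrite scoefB //= subrr.
Qed.
Fact series_const_monoid : monoid_morphism series_const.
Proof.
split=> // x y; apply/seriesP => n; rewrite scoef_constM /=.
by case: eqP => _; rewrite ?mulr0.
Qed.
HB.instance Definition _ :=
  GRing.isZmodMorphism.Build R (series R) series_const series_const_zmod.
HB.instance Definition _ :=
  GRing.isMonoidMorphism.Build R (series R) series_const series_const_monoid.

Lemma series_var_reg : GRing.lreg series_var.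
Proof.
move=> a b eq_ab; apply/seriesP => n.
by move/(congr1 (fun c : series R => c n.+1)): eq_ab; rewrite !scoef_varM.
Qed.

(** A series with constant coefficient 1 can be cancelled: the coefficients of
    the cofactor are determined one after the other. *)
Lemma series_unit_reg a : a 0%N = 1 -> GRing.lreg a.
Proof.
move=> a0; suff reg c : a * c = 0 -> c = 0.
  by move=> b c /eqP; rewrite -subr_eq0 -mulrBr => /eqP/reg/eqP;
    rewrite subr_eq0 => /eqP.
move=> ac0; apply/seriesP => n; elim/ltn_ind: n => n IHn.
move/(congr1 (fun b : series R => b n)): ac0.
rewrite scoefM big_ord_recl a0 mul1r subn0 big1 ?addr0 // => i _.
by rewrite /= IHn ?mulr0 // /bump /= add1n subnS; case: n i {IHn} => [[] //|n i] /=;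
  rewrite -subnS subSS ltnS leq_subr.
Qed.

Definition series_deriv a : series R := Series (fun n => a n.+1 *+ n.+1).

Lemma series_derivM a b :
  series_deriv (a * b) = series_deriv a * b + a * series_deriv b.
Proof.
have der c n i : (i <= n)%N -> ((trunc n.+1 c)^`())`_i = series_deriv c i.
  by move=> le_in; rewrite coef_deriv truncE.
apply/seriesP => n; transitivity ((trunc n.+1 a * trunc n.+1 b)^`())`_n.
  by rewrite coef_deriv truncM.
rewrite scoefD derivM coefD.
by congr (_ + _); apply: series_mul_poly => i le_in;
  rewrite ?der ?truncE // (leq_trans le_in).
Qed.

Lemma series_derivD a b : series_deriv (a + b) = series_deriv a + series_deriv b.
Proof. by apply/seriesP => n /=; rewrite mulrnDl. Qed.
Lemma series_derivN a : series_deriv (- a) = - series_deriv a.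
Proof. by apply/seriesP => n /=; rewrite mulNrn. Qed.
Lemma series_deriv_const k : series_deriv (series_const k) = 0.
Proof. by apply/seriesP => n /=; rewrite mul0rn. Qed.
Lemma series_deriv_var : series_deriv series_var = 1.
Proof. by apply/seriesP => -[|n] //=; rewrite mul0rn. Qed.

End SeriesRing.

Arguments series_var {R}.

(** * Coefficientwise maps *)

Definition series_map (A B : Type) (g : A -> B) (a : series A) : series B :=
  Series (fun n => g (a n)).

Fact series_map_zmod (V W : zmodType) (f : {additive V -> W}) :
  zmod_morphism (series_map f).
Proof. by move=> a b; apply/seriesP => n /=; rewrite raddfB. Qed.
HB.instance Definition _ (V W : zmodType) (f : {additive V -> W}) :=
  GRing.isZmodMorphism.Build (series V) (series W) (series_map f)
    (series_map_zmod f).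

Section SeriesMap.
Variables (A B : comNzRingType) (f : {rmorphism A -> B}).

Fact series_map_monoid : monoid_morphism (series_map f).
Proof.
split=> [|a b]; apply/seriesP => n /=; first by case: eqP; rewrite ?rmorph1 ?rmorph0.
by rewrite raddf_sum /=; apply: eq_bigr => i _; rewrite rmorphM.
Qed.
HB.instance Definition _ :=
  GRing.isMonoidMorphism.Build (series A) (series B) (series_map f)
    series_map_monoid.

Lemma series_map_var : series_map f series_var = series_var.
Proof. by apply/seriesP => n /=; rewrite rmorph_nat. Qed.
Lemma series_map_const k : series_map f (series_const k) = series_const (f k).
Proof. by apply/seriesP => n /=; case: eqP; rewrite ?rmorph0. Qed.
End SeriesMap.

(** * Polynomials biorthogonal for the moments *)

(** Here [p] stands for the generating series of the polynomials [biorth b],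
    [p'] for its derivative in [s] and [q] for its derivative in the variable
    [z].  Since [p] is rational, clearing its denominator [D] twice leaves a
    polynomial identity; it only has to hold modulo [b ^+ 2 - b + 1].  The right
    side is [(1 - 2 b) s (1 - s)] times the operator [moment_op] of [z], whose
    values are annihilated by the moment functional, so the left side becomes a
    differential equation in [s] for the image of [p]. *)
Lemma ode_identity (R : comNzRingType) (b s z p p' q D : R) :
  D = (1 - b * s) ^+ 3 - z * (1 - 2 * b) * s * (1 - s) ->
  b ^+ 2 = b - 1 -> GRing.lreg D ->
  D * p = (1 - b * s) ^+ 2 ->
  D * p' = - 2 * b * (1 - b * s)
    + (3 * b * (1 - b * s) ^+ 2 + z * (1 - 2 * b) * (1 - 2 * s)) * p ->
  D * q = (1 - 2 * b) * s * (1 - s) * p ->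
  (1 - b * s) * ((1 - (1 - b) * s) * s * (1 - s) * p'
                 + (1 - (1 + b) * s) * p - (1 - b * s))
  = (1 - 2 * b) * s * (1 - s) * (z * (z - 3) * q + (2 * z - 1) * p).
Proof.
move=> defD b2 regD Dp Dp' Dq; apply: (regD); apply: (regD).
have D2p' : D * (D * p') = - 2 * b * (1 - b * s) * D
    + (3 * b * (1 - b * s) ^+ 2 + z * (1 - 2 * b) * (1 - 2 * s)) * (1 - b * s) ^+ 2.
  by rewrite Dp' -Dp; ring.
have D2q : D * (D * q) = (1 - 2 * b) * s * (1 - s) * (1 - b * s) ^+ 2.
  by rewrite Dq -Dp; ring.
have -> : D * (D * ((1 - b * s) * ((1 - (1 - b) * s) * s * (1 - s) * p'
                 + (1 - (1 + b) * s) * p - (1 - b * s)))) =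
  (1 - b * s) * ((1 - (1 - b) * s) * s * (1 - s) * (D * (D * p'))
                 + (1 - (1 + b) * s) * (D * p) * D - (1 - b * s) * D * D) by ring.
have -> : D * (D * ((1 - 2 * b) * s * (1 - s) * (z * (z - 3) * q + (2 * z - 1) * p)))
  = (1 - 2 * b) * s * (1 - s) * (z * (z - 3) * (D * (D * q)) + (2 * z - 1) * (D * p) * D).
  by ring.
rewrite D2p' D2q Dp; apply/eqP; rewrite -subr_eq0; apply/eqP.
(* The quotient of the difference by [b ^+ 2 - b + 1]. *)
transitivity (- s ^+ 2 * (1 - b * s) ^+ 6 * (b ^+ 2 - (b - 1))).
  by rewrite defD; ring.
by rewrite b2; ring.
Qed.

Lemma series_map_mul (A B : comNzRingType) (g : {additive A -> B})
    (k a : series A) (l : series B) :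
  (forall i j, g (k i * a j) = l i * g (a j)) ->
  series_map g (k * a) = l * series_map g a.
Proof.
move=> gka; apply/seriesP => n; rewrite /= raddf_sum.
by apply: eq_bigr => i _; rewrite gka.
Qed.

Lemma series_deriv1 (R : comNzRingType) : series_deriv (1 : series R) = 0.
Proof. exact: series_deriv_const. Qed.

(** The coefficient of order [n] of the left side is [(n + 1) * d n] plus a
    combination of lower coefficients of [d], so they all vanish in turn. *)
Lemma euler_ode_unique (K : numFieldType) (y w d : series K) :
  y 0%N = 1 -> w 0%N = 1 -> y * (series_var * series_deriv d) + w * d = 0 -> d = 0.
Proof.
move=> y0 w0 eq0; apply/seriesP => n; elim/ltn_ind: n => n IHn.
have low (a b : series K) : a 0%N = 1 -> (forall i, (i < n)%N -> b i = 0) ->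
    (a * b) n = b n.
  move=> a0 bi; rewrite scoefM big_ord_recl a0 mul1r subn0 big1 ?addr0 // => i _.
  rewrite [X in _ * X]bi ?mulr0 // lift0; case: n i {IHn bi} => [[] //|n i].
  by rewrite subSS ltnS leq_subr.
have sd i : (series_var * series_deriv d) i = d i *+ i.
  by rewrite scoef_varM; case: i.
move/(congr1 (fun b : series K => b n)): eq0.
rewrite scoefD (low y) ?(low w) //; last by move=> i /IHn; rewrite sd => ->; rewrite mul0rn.
by rewrite sd -mulrSr scoef0 => /eqP; rewrite -mulr_natr mulf_eq0 pnatr_eq0 orbF => /eqP.
Qed.

Section Biorthogonal.
Variable K : numFieldType.
Implicit Types (b : K) (q : {poly K}).

(** The recurrence is the one encoded by the denominator
    [(1 - b s) ^+ 3 - (1 - 2 b) s (1 - s) 'X] of the generating series, whose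
    cubic term is [s ^+ 3] because [b ^+ 3 = -1]; the initial values encode the
    numerator [(1 - b s) ^+ 2]. *)
Fixpoint biorth b n : {poly K} :=
  let e := (1 - 2 * b) *: 'X in
  match n with
  | 0 => 1
  | n1.+1 => match n1 with
    | 0 => b%:P + e
    | n2.+1 => match n2 with
      | 0 => (3 * b%:P + e) * (b%:P + e) - (3 * b%:P ^+ 2 + e) + b%:P ^+ 2
      | n3.+1 =>
          (3 * b%:P + e) * biorth b n1 - (3 * b%:P ^+ 2 + e) * biorth b n2
          - biorth b n3
      end
    end
  end.

Lemma biorthS3 b n : biorth b n.+3 =
  (3 * b%:P + (1 - 2 * b) *: 'X) * biorth b n.+2
  - (3 * b%:P ^+ 2 + (1 - 2 * b) *: 'X) * biorth b n.+1 - biorth b n.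
Proof. by []. Qed.

Let lift := series_map (@polyC K).
Let s : series {poly K} := series_var.
Let Z : series {poly K} := series_const 'X.
Let B b : series {poly K} := series_const b%:P.

Lemma biorth_gf b : b ^+ 2 = b - 1 ->
  ((1 - B b * s) ^+ 3 - Z * (1 - 2 * B b) * s * (1 - s)) * Series (biorth b)
  = (1 - B b * s) ^+ 2.
Proof.
move=> b2; set P := Series _.
have B2 : B b ^+ 2 = B b - 1 by rewrite -!rmorphXn /= b2 !rmorphB !rmorph1.
have eZ : Z * (1 - 2 * B b) = series_const ((1 - 2 * b) *: 'X).
  rewrite -mul_polyC mulrC rmorphM /=; congr (_ * Z).
  by rewrite !(rmorphB, rmorphM, rmorph_nat, rmorph1).
have -> : ((1 - B b * s) ^+ 3 - Z * (1 - 2 * B b) * s * (1 - s)) * P =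
  P - (3 * B b + Z * (1 - 2 * B b)) * (s * P)
    + (3 * B b ^+ 2 + Z * (1 - 2 * B b)) * (s * (s * P)) + s * (s * (s * P)).
  apply/eqP; rewrite -subr_eq0; apply/eqP.
  transitivity (- (B b + 1) * s ^+ 3 * P * (B b ^+ 2 - (B b - 1))); first by ring.
  by rewrite B2; ring.
have -> : (1 - B b * s) ^+ 2 = 1 - 2 * B b * (s * 1) + B b ^+ 2 * (s * (s * 1)) by ring.
rewrite eZ.
have n2 k : k%:R = series_const (k%:R : {poly K}) by rewrite rmorph_nat.
rewrite !n2 -!rmorphXn -!(rmorphM, rmorphD) /=; apply/seriesP => n.
rewrite !(scoefD, scoefN) !(scoef_constM, scoef_varM).
case: n => [|[|[|n]]]; rewrite ?scoef_varM /=.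
- by ring.
- by ring.
- by ring.
by ring.
Qed.

End Biorthogonal.

Section Functional.
Variables (K : numFieldType) (L : {scalar {poly K}}).
Hypothesis L1 : L 1 = 2.
Hypothesis Lrec : forall k, L 'X^(k.+1) *+ k.+2 = L 'X^k *+ (3 * k).+1.

Local Notation lift := (series_map (@polyC K)).
Let s : series K := series_var.
Let S : series {poly K} := series_var.
Let Z : series {poly K} := series_const 'X.

Lemma map_lift (g : {linear {poly K} -> {poly K}}) k (a : series {poly K}) :
  series_map g (lift k * a) = lift k * series_map g a.
Proof. by apply: series_map_mul => i j; rewrite /= !mul_polyC linearZ. Qed.

Lemma mapL_lift k (a : series {poly K}) :
  series_map L (lift k * a) = k * series_map L a.
Proof. by apply: series_map_mul => i j; rewrite /= !mul_polyC linearZ. Qed.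

Lemma mapLD (a c : series {poly K}) :
  series_map L (a + c) = series_map L a + series_map L c.
Proof. exact: (raddfD (series_map L)). Qed.

Lemma mapLB (a c : series {poly K}) :
  series_map L (a - c) = series_map L a - series_map L c.
Proof. exact: (raddfB (series_map L)). Qed.

(** The first-order operator sending ['X^k] to
    [(k + 2) 'X^(k+1) - (3 k + 1) 'X^k]: the recurrence of the moments says that
    the functional vanishes on its image. *)
Definition moment_op (p : {poly K}) := 'X * ('X - 3) * p^`() + (2 * 'X - 1) * p.

Lemma functional_moment_op p : L (moment_op p) = 0.
Proof.
rewrite -[p]coefK poly_def; elim/big_rec: _ => [|i q _ IHq].
  by rewrite /moment_op deriv0 !mulr0 addr0 raddf0.
have -> : moment_op (p`_i *: 'X^i + q) = p`_i *: moment_op 'X^i + moment_op q.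
  by rewrite /moment_op derivD derivZ -!mul_polyC; ring.
rewrite raddfD /= linearZ /= [L (moment_op q)]IHq addr0.
have -> k : moment_op 'X^k = 'X^(k.+1) *+ k.+2 - 'X^k *+ (3 * k).+1.
  rewrite /moment_op derivXn; case: k => [|k]; first by rewrite mulr0n expr1 expr0; ring.
  rewrite -mulr_natr -[_ *+ k.+3]mulr_natr -[_ *+ (3 * _).+1]mulr_natr /= !exprS.
  by rewrite -[k.+3]addn3 -[(3 * _).+1]addn1 -[k.+1]addn1 mulnDr !natrD natrM; ring.
have Lm : L ('X^(i.+1) *+ i.+2 - 'X^i *+ (3 * i).+1) = 0.
  by rewrite (raddfB L) !(raddfMn L) /= Lrec; apply: subrr.
by rewrite Lm mulr0.
Qed.

Variable b : K.
Hypothesis b2 : b ^+ 2 = b - 1.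
Let P := Series (biorth b).
Let sb : series K := series_const b.
Let B : series {poly K} := series_const b%:P.
Let u : series K := (1 - sb * s) ^+ 3.
Let v : series K := (1 - 2 * sb) * s * (1 - s).

Lemma lift_b : lift sb = B. Proof. exact: series_map_const. Qed.
Lemma lift_s : lift s = S. Proof. exact: series_map_var. Qed.

Lemma biorth_gf_lift : (lift u - Z * lift v) * P = lift ((1 - sb * s) ^+ 2).
Proof.
rewrite /u /v !(rmorphXn, rmorphB, rmorphM, rmorph1, rmorph_nat) /= lift_b lift_s.
by rewrite -(biorth_gf b2) -/S -/Z -/B -/P; ring.
Qed.

Lemma biorth_gf_derivX : (lift u - Z * lift v) * series_map deriv P = lift v * P.
Proof.
have := congr1 (series_map deriv) biorth_gf_lift.
rewrite -[lift (_ ^+ 2)]mulr1 !map_lift.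
have -> : series_map deriv 1 = 0 :> series {poly K}.
  by apply/seriesP => -[|n] /=; rewrite ?deriv0 // -polyC1 derivC.
have -> : series_map deriv ((lift u - Z * lift v) * P) =
    (lift u - Z * lift v) * series_map deriv P - lift v * P.
  have -> : (lift u - Z * lift v) * P = lift u * P - lift v * (Z * P) by ring.
  rewrite (raddfB (series_map deriv)) /= !map_lift.
  have -> : series_map deriv (Z * P) = P + Z * series_map deriv P.
    apply/seriesP => n; transitivity (('X * P n)^`()); first by rewrite -scoef_constM.
    by rewrite scoefD scoef_constM derivM derivX mul1r.
  by ring.
by move=> /eqP; rewrite mulr0 subr_eq0 => /eqP.
Qed.


Lemma map_series_deriv : series_map L (series_deriv P) = series_deriv (series_map L P).
Proof. by apply/seriesP => n /=; rewrite raddfMn. Qed.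

Lemma biorth_unit : (lift u - Z * lift v) 0%N = 1.
Proof.
rewrite scoefB scoef_constM.
have -> : (lift u) 0%N = (u 0%N)%:P by [].
have -> : (lift v) 0%N = (v 0%N)%:P by [].
have -> : u = 1 + s * (- 3 * sb + 3 * sb ^+ 2 * s - sb ^+ 3 * s ^+ 2).
  by rewrite /u; ring.
have -> : v = s * ((1 - 2 * sb) * (1 - s)) by rewrite /v; ring.
by rewrite scoefD !scoef_varM addr0 mulr0 subr0.
Qed.

(** Applying the functional to [ode_identity] kills the right side and leaves a
    first-order equation with a unique power series solution; [1 + 1 / (1 - s)]
    solves it. *)
Lemma functional_biorth : series_map L P = 1 + Series (fun _ => 1).
Proof.
have B2 : B ^+ 2 = B - 1 by rewrite -rmorphXn /= -rmorphXn /= b2 !rmorphB !rmorph1.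
have DE : (1 - B * S) ^+ 3 - Z * (1 - 2 * B) * S * (1 - S) = lift u - Z * lift v.
  rewrite /u /v !(rmorphXn, rmorphB, rmorphM, rmorph1, rmorph_nat) /= lift_b lift_s.
  by ring.
have gf : (lift u - Z * lift v) * P = (1 - B * S) ^+ 2.
  by rewrite -DE; apply: biorth_gf.
have ode := ode_identity (esym DE) B2 (series_unit_reg biorth_unit) gf.
have dgf : (lift u - Z * lift v) * series_deriv P = - 2 * B * (1 - B * S)
    + (3 * B * (1 - B * S) ^+ 2 + Z * (1 - 2 * B) * (1 - 2 * S)) * P.
  have := congr1 (@series_deriv _) gf; rewrite -DE series_derivM.
  have der c : series_deriv (series_const c * S) = series_const c.
    by rewrite series_derivM series_deriv_const series_deriv_var mul0r add0r mulr1.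
  have derBS : series_deriv (1 - B * S) = - B.
    by rewrite series_derivD series_derivN series_deriv1 der add0r.
  have -> : series_deriv ((1 - B * S) ^+ 2) = - 2 * B * (1 - B * S).
    by rewrite expr2 series_derivM derBS; ring.
  have -> : series_deriv ((1 - B * S) ^+ 3 - Z * (1 - 2 * B) * S * (1 - S)) =
      - 3 * B * (1 - B * S) ^+ 2 - Z * (1 - 2 * B) * (1 - 2 * S).
    have -> : Z * (1 - 2 * B) * S * (1 - S) = Z * (1 - 2 * B) * S * (1 - 1 * S) by ring.
    have -> : Z * (1 - 2 * B) = series_const ('X * (1 - 2 * b%:P)).
      by rewrite rmorphM rmorphB rmorphM rmorph1 rmorph_nat.
    rewrite series_derivD series_derivN exprS expr2 [in X in X - _]series_derivM.
    rewrite [in X in X - _]series_derivM derBS [in X in _ - X]series_derivM.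
    have dS : series_deriv (1 - 1 * S) = - 1.
      by rewrite mul1r series_derivD series_derivN series_deriv1 series_deriv_var add0r.
    rewrite dS der; ring.
  move=> eq1.
  apply/eqP; rewrite -subr_eq0; apply/eqP.
  move/eqP: eq1; rewrite -subr_eq0 => /eqP <-; ring.
have {}ode := ode _ _ dgf.
have dX : (lift u - Z * lift v) * series_map deriv P = (1 - 2 * B) * S * (1 - S) * P.
  rewrite biorth_gf_derivX /v !(rmorphXn, rmorphB, rmorphM, rmorph1, rmorph_nat) /=.
  by rewrite lift_b lift_s.
have {}ode := ode _ dX.
have Top : Z * (Z - 3) * series_map deriv P + (2 * Z - 1) * P = series_map moment_op P.
  have -> : Z * (Z - 3) = series_const ('X * ('X - 3)).
    by rewrite rmorphM rmorphB rmorph_nat.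
  have -> : 2 * Z - 1 = series_const (2 * 'X - 1).
    by rewrite rmorphB rmorphM rmorph_nat rmorph1.
  by apply/seriesP => n; rewrite scoefD !scoef_constM.
have LT : series_map L (series_map moment_op P) = 0.
  by apply/seriesP => n; apply: functional_moment_op.
have L1s : series_map L 1 = 2.
  rewrite -[2](rmorph_nat (@series_const K)); apply/seriesP => n /=.
  by case: eqP; rewrite ?L1 ?raddf0.
set E := series_map L P.
have Eode : (1 - (1 - sb) * s) * s * (1 - s) * series_deriv E
      + (1 - (1 + sb) * s) * E - 2 * (1 - sb * s) = 0.
  have reg1 : GRing.lreg (1 - sb * s).
    by apply: series_unit_reg; rewrite scoefB scoef_constM mulr0 subr0.
  apply: reg1; rewrite mulr0.
  have := congr1 (series_map L) ode; rewrite Top.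
  have -> : (1 - 2 * B) * S * (1 - S) = lift v.
    rewrite /v !(rmorphXn, rmorphB, rmorphM, rmorph1, rmorph_nat) /=.
    by rewrite lift_b lift_s.
  rewrite mapL_lift LT mulr0 => <-.
  have -> : 1 - B * S = lift (1 - sb * s).
    by rewrite !(rmorphB, rmorphM, rmorph1) /= lift_b lift_s.
  have -> : (1 - (1 - B) * S) * S * (1 - S) = lift ((1 - (1 - sb) * s) * s * (1 - s)).
    by rewrite !(rmorphB, rmorphM, rmorph1) /= lift_b lift_s.
  have -> : 1 - (1 + B) * S = lift (1 - (1 + sb) * s).
    by rewrite !(rmorphB, rmorphM, rmorphD, rmorph1) /= lift_b lift_s.
  rewrite mapL_lift -[in RHS](mulr1 (lift (1 - sb * s))) mapLB.
  rewrite mapLD !mapL_lift map_series_deriv L1s -/E; ring.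
set G : series K := Series (fun _ => 1).
have sG : (1 - s) * G = 1.
  apply/seriesP => n; rewrite mulrBl mul1r scoefB scoef_varM /=.
  by case: n => [|n] /=; rewrite ?subr0 ?subrr.
have dG : (1 - s) * series_deriv G = G.
  apply/seriesP => n; rewrite mulrBl mul1r scoefB scoef_varM /=.
  by case: n => [|n] /=; rewrite ?subr0 // mulrSr addrAC subrr add0r.
apply/eqP; rewrite -subr_eq0; apply/eqP.
apply: (@euler_ode_unique _ ((1 - (1 - sb) * s) * (1 - s)) (1 - (1 + sb) * s)).
- have -> : (1 - (1 - sb) * s) * (1 - s) = 1 + s * (- (1 - sb) * (1 - s) - 1) by ring.
  by rewrite scoefD scoef_varM addr0.
- have -> : 1 - (1 + sb) * s = 1 + s * (- (1 + sb)) by ring.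
  by rewrite scoefD scoef_varM addr0.
rewrite series_derivD series_derivN series_derivD series_deriv1 add0r -/s.
have reg2 : GRing.lreg (1 - s).
  by apply: series_unit_reg; rewrite scoefB subr0.
transitivity ((1 - (1 - sb) * s) * s * (1 - s) * series_deriv E
      + (1 - (1 + sb) * s) * E - 2 * (1 - sb * s)
   - ((1 - (1 - sb) * s) * s * ((1 - s) * series_deriv G)
      + (1 - (1 + sb) * s) * (1 + G) - 2 * (1 - sb * s))); first by ring.
rewrite Eode dG sub0r; apply: reg2; rewrite mulr0.
transitivity (- ((1 - (1 - sb) * s) * s * ((1 - s) * G)
      + (1 - (1 + sb) * s) * ((1 - s) + (1 - s) * G) - 2 * (1 - sb * s) * (1 - s))).
  by ring.
by rewrite sG; ring.
Qed.
Let F q := series_map L (P * series_const q).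

Lemma functional_seriesB q r : F (q - r) = F q - F r.
Proof. by rewrite /F rmorphB mulrBr mapLB. Qed.

Lemma functional_seriesZ k q : F (k%:P * q) = series_const k * F q.
Proof.
rewrite /F rmorphM /= mulrCA.
have -> : series_const k%:P = lift (series_const k) by rewrite series_map_const.
exact: mapL_lift.
Qed.

(** The defining relation of the generating series, multiplied by [q], with the
    functional applied to its coefficients.  It expresses multiplication by ['X]
    inside the functional through multiplication by series in [s]. *)
Lemma functional_gf q :
  u * F q - s * (1 - s) * F ((1 - 2 * b)%:P * ('X * q))
  = (1 - sb * s) ^+ 2 * series_const (L q).
Proof.
have -> : series_const (L q) = series_map L (series_const q).
  by apply/seriesP => n /=; case: eqP; rewrite ?raddf0.
rewrite -[RHS]mapL_lift -biorth_gf_lift.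
have -> : (lift u - Z * lift v) * P * series_const q =
    lift u * (P * series_const q) - lift v * (P * series_const ('X * q)).
  by rewrite rmorphM /= -/Z; ring.
rewrite mapLB !mapL_lift functional_seriesZ /v -/(F q) -/(F ('X * q)).
by rewrite rmorphB rmorphM rmorph1 rmorph_nat -/sb; ring.
Qed.

Lemma functional_biorth_coef n : L (biorth b n) = 1 + (n == 0%N)%:R.
Proof.
have := congr1 (fun a : series K => a n) functional_biorth.
by rewrite scoefD /= => ->; rewrite addrC; case: n.
Qed.

End Functional.

(** * Biorthogonality *)

Definition pascal_series (R : comNzRingType) j : series R :=
  Series (fun i => 'C(i + j, i)%:R).

Lemma pascal_series0 (R : comNzRingType) :
  (1 - series_var) * pascal_series R 0 = 1.
Proof.
apply/seriesP => i; rewrite mulrBl mul1r scoefB scoef_varM /= addn0 binn.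
by case: i => [|i] /=; rewrite ?subr0 // addn0 binn subrr.
Qed.

(** Pascal's rule; together with [pascal_series0] it identifies
    [pascal_series j] with [(1 - s) ^- (j + 1)]. *)
Lemma pascal_seriesS (R : comNzRingType) j :
  (1 - series_var) * pascal_series R j.+1 = pascal_series R j.
Proof.
apply/seriesP => i; rewrite mulrBl mul1r scoefB scoef_varM /=.
case: i => [|i] /=; first by rewrite subr0 !bin0.
by rewrite addnS binS [X in 'C(X, i)]addSnnS natrD addrK addSnnS.
Qed.

(** For fixed [j], the series in [i] of the values is [s ^+ j + (1 - s) ^- (j+1)].
    This goes by induction on [j]: eliminating ['X] between the recurrence of
    [biorth (1 - b)] and [functional_gf] gives a third-order recurrence in [j],
    whose leading coefficient [s (1 - s)] can be cancelled.  Its solutions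
    include the powers of [s] and of [1 / (1 - s)] because
    [(1 - (1 - b) (1 - s)) ^+ 3 = - (1 - b s) ^+ 3]. *)
Lemma biorthogonal (K : numFieldType) (L : {scalar {poly K}}) b
    (L1 : L 1 = 2)
    (Lrec : forall k, L 'X^(k.+1) *+ k.+2 = L 'X^k *+ (3 * k).+1)
    (b2 : b ^+ 2 = b - 1) i j :
  L (biorth b i * biorth (1 - b) j) = (i == j)%:R + 'C(i + j, i)%:R.
Proof.
pose s : series K := series_var; pose sb : series K := series_const b.
pose P := Series (biorth b).
pose F q := series_map L (P * series_const q).
pose q := biorth (1 - b).
suff Fq : forall n, F (q n) = s ^+ n + pascal_series K n.
  have PqE : (P * series_const (q j)) i = biorth b i * q j.
    by rewrite mulrC scoef_constM mulrC.
  by rewrite -/(q j) -PqE -[LHS]/(F (q j) i) Fq scoefD scoef_varX.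
have sb2 : sb ^+ 2 = sb - 1 by rewrite -rmorphXn /= b2 rmorphB rmorph1.
have a2 : (1 - b) ^+ 2 = (1 - b) - 1 by rewrite sqrrB b2; ring.
have Lq n : L (q n) = 1 + (n == 0%N)%:R by apply: functional_biorth_coef.
have regr : GRing.lreg (1 - s) by apply: series_unit_reg; rewrite scoefB subr0.
have regk : GRing.lreg (s * (1 - s)) by apply: lregM => //; apply: series_var_reg.
have gf p : (1 - sb * s) ^+ 3 * F p - s * (1 - s) * F ((1 - 2 * b)%:P * ('X * p))
    = (1 - sb * s) ^+ 2 * series_const (L p) by apply: functional_gf.
have LB p r : L (p - r) = L p - L r := raddfB L p r.
have FB p r : F (p - r) = F p - F r by apply: functional_seriesB.
have FZ k p : F (k%:P * p) = series_const k * F p by apply: functional_seriesZ.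
have FN k : series_const (k%:R : K) = k%:R by rewrite rmorph_nat.
have Fb : series_const (1 - b) = 1 - sb by rewrite rmorphB rmorph1.
have W0 : (1 - s) * pascal_series K 0 = 1 := pascal_series0 K.
have WS n : (1 - s) * pascal_series K n.+1 = pascal_series K n := pascal_seriesS K n.
have F0 : F (q 0%N) = 1 + pascal_series K 0.
  rewrite /F /q /= rmorph1 mulr1 (functional_biorth L1 Lrec b2); congr (_ + _).
  by apply/seriesP => n; rewrite /= addn0 binn.
have F1 : F (q 1%N) = s + pascal_series K 1.
  have := gf (q 0%N); rewrite [L (q 0%N)]L1 FN.
  have -> : (1 - 2 * b)%:P * ('X * q 0%N) = (1 - b)%:P * q 0%N - q 1%N.
    rewrite /q /= mulr1 -!mul_polyC !(rmorphB, rmorphM, rmorph_nat, rmorph1); ring.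
  rewrite FB FZ Fb => eq.
  have kF1 : s * (1 - s) * F (q 1%N) = (1 - sb * s) ^+ 2 * 2
      - (1 - sb * s) ^+ 3 * F (q 0%N) + s * (1 - s) * ((1 - sb) * F (q 0%N)).
    by rewrite -eq; ring.
  (* Powers of [1 - s] clear the denominators of the two known series. *)
  do 2 apply: (regr); apply: (regk).
  have e0 : (1 - s) * ((1 - s) * F (q 0%N)) = (1 - s) ^+ 2 + (1 - s).
    rewrite F0 [(1 - s) * (1 + _)]mulrDr W0; ring.
  have e1 : (1 - s) * ((1 - s) * (s + pascal_series K 1)) = (1 - s) ^+ 2 * s + 1.
    rewrite [(1 - s) * (s + _)]mulrDr WS [(1 - s) * (_ + _)]mulrDr W0; ring.
  rewrite e1; transitivity ((1 - s) * ((1 - s) * (s * (1 - s) * F (q 1%N)))).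
    by ring.
  rewrite kF1; transitivity ((1 - s) ^+ 2 * ((1 - sb * s) ^+ 2 * 2)
    + (s * (1 - s) * (1 - sb) - (1 - sb * s) ^+ 3) * ((1 - s) * ((1 - s) * F (q 0%N)))).
    by ring.
  rewrite e0; apply/eqP; rewrite -subr_eq0; apply/eqP.
  (* Both sides agree modulo [sb ^+ 2 - sb + 1]; the cofactor is explicit. *)
  transitivity (s ^+ 2 * (1 - s) * (sb ^+ 2 - (sb - 1))
    * (- 4 + 3 * s - s ^+ 2 + 2 * sb * s - sb * s ^+ 2)); first by ring.
  by rewrite sb2; ring.
have F2 : F (q 2%N) = s ^+ 2 + pascal_series K 2.
  have := gf (q 1%N - q 0%N); rewrite LB !Lq /=.
  have -> : (1 - 2 * b)%:P * ('X * (q 1%N - q 0%N)) =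
      (3 * (1 - b))%:P * q 1%N - (2 * (1 - b) ^+ 2)%:P * q 0%N - q 2%N.
    rewrite /q /= mulr1 -!mul_polyC.
    rewrite !(rmorphB, rmorphM, rmorph_nat, rmorph1, rmorphXn) /=.
    rewrite ?(rmorphB, rmorph1); ring.
  rewrite !FB !FZ !(rmorphM, rmorph_nat, rmorphXn) /= Fb => eq.
  have kF2 : s * (1 - s) * F (q 2%N) = - (1 - sb * s) ^+ 2
      - (1 - sb * s) ^+ 3 * (F (q 1%N) - F (q 0%N))
      + s * (1 - s) * (3 * (1 - sb) * F (q 1%N) - 2 * (1 - sb) ^+ 2 * F (q 0%N)).
    have -> : - (1 - sb * s) ^+ 2 = (1 - sb * s) ^+ 2 * series_const (1 + 0 - (1 + 1)).
      by rewrite rmorphB !rmorphD rmorph1 rmorph0; ring.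
    by rewrite -eq; ring.
  (* Powers of [1 - s] clear the denominators of the two known series. *)
  do 3 apply: (regr); apply: (regk).
  have e0 : (1 - s) * ((1 - s) * ((1 - s) * F (q 0%N))) = (1 - s) ^+ 3 + (1 - s) ^+ 2.
    rewrite F0 [(1 - s) * (1 + _)]mulrDr W0; ring.
  have e1 : (1 - s) * ((1 - s) * ((1 - s) * F (q 1%N))) = (1 - s) ^+ 3 * s + (1 - s).
    rewrite F1 [(1 - s) * (s + _)]mulrDr WS [(1 - s) * (_ + _)]mulrDr W0; ring.
  have e2 : (1 - s) * ((1 - s) * ((1 - s) * (s ^+ 2 + pascal_series K 2)))
      = (1 - s) ^+ 3 * s ^+ 2 + 1.
    rewrite [(1 - s) * (s ^+ 2 + _)]mulrDr WS [(1 - s) * (_ + _)]mulrDr WS.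
    rewrite [(1 - s) * (_ + _)]mulrDr W0; ring.
  rewrite e2.
  transitivity ((1 - s) * ((1 - s) * ((1 - s) * (s * (1 - s) * F (q 2%N))))).
    by ring.
  rewrite kF2; transitivity (- (1 - s) ^+ 3 * (1 - sb * s) ^+ 2
    + (s * (1 - s) * 3 * (1 - sb) - (1 - sb * s) ^+ 3)
       * ((1 - s) * ((1 - s) * ((1 - s) * F (q 1%N))))
    - (s * (1 - s) * 2 * (1 - sb) ^+ 2 - (1 - sb * s) ^+ 3)
       * ((1 - s) * ((1 - s) * ((1 - s) * F (q 0%N))))).
    by ring.
  rewrite e0 e1; apply/eqP; rewrite -subr_eq0; apply/eqP.
  (* Both sides agree modulo [sb ^+ 2 - sb + 1]; the cofactor is explicit. *)
  transitivity (s * (sb ^+ 2 - (sb - 1))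
    * (- 4 + 16 * s - 31 * s ^+ 2 + 33 * s ^+ 3 - 20 * s ^+ 4 + 7 * s ^+ 5 - s ^+ 6
       - sb * s ^+ 2 + 5 * sb * s ^+ 3 - 7 * sb * s ^+ 4 + 4 * sb * s ^+ 5
       - sb * s ^+ 6)); first by ring.
  by rewrite sb2; ring.
have step n : F (q n) = s ^+ n + pascal_series K n ->
    F (q n.+1) = s ^+ n.+1 + pascal_series K n.+1 ->
    F (q n.+2) = s ^+ n.+2 + pascal_series K n.+2 ->
    F (q n.+3) = s ^+ n.+3 + pascal_series K n.+3.
  move=> Fn Fn1 Fn2; have := gf (q n.+2 - q n.+1); rewrite LB !Lq /= subrr.
  have -> : (1 - 2 * b)%:P * ('X * (q n.+2 - q n.+1)) =
      (3 * (1 - b))%:P * q n.+2 - (3 * (1 - b) ^+ 2)%:P * q n.+1 - q n - q n.+3.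
    have -> : q n.+3 = _ := biorthS3 (1 - b) n.
    rewrite -/(q n.+2) -/(q n.+1) -/(q n) -!mul_polyC.
    rewrite !(rmorphB, rmorphM, rmorph_nat, rmorph1, rmorphXn) /=.
    rewrite ?(rmorphB, rmorph1); ring.
  rewrite !FB !FZ !(rmorphM, rmorph_nat, rmorphXn, rmorph0) /= Fb mulr0 => eq.
  apply: (regk); rewrite -[LHS]subr0 -eq Fn Fn1 Fn2.
  set V := pascal_series K n.+3.
  rewrite -(WS n) -(WS n.+1) -(WS n.+2) -/V !(exprS s).
  apply/eqP; rewrite -subr_eq0; apply/eqP.
  (* Both sides agree modulo [sb ^+ 2 - sb + 1]; the cofactor is explicit. *)
  transitivity (- (sb ^+ 2 - (sb - 1)) * s * (1 - s) *
    (s * (3 - 3 * s + s ^+ 2 + sb * s ^+ 2) * s ^+ n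
     + (3 - 6 * s + 6 * s ^+ 2 - s ^+ 3 - sb * s ^+ 3) * V)); first by ring.
  by rewrite sb2; ring.
elim/ltn_ind=> -[|[|[|n]]] IHn //; apply: step; apply: IHn; lia.
Qed.

(** * The Hankel determinant of the moments *)

Definition moment (K : nzRingType) (m : nat -> K) (p : {poly K}) : K :=
  \sum_(i < size p) p`_i * m i.

Lemma momentE (K : nzRingType) (m : nat -> K) (p : {poly K}) n :
  (size p <= n)%N -> moment m p = \sum_(i < n) p`_i * m i.
Proof.
move=> le_pn; rewrite /moment (big_ord_widen _ (fun i => p`_i * m i) le_pn) big_mkcond.
by apply: eq_bigr => i _; case: ltnP => // /leq_sizeP->; rewrite ?mul0r.
Qed.

Lemma moment_is_scalar (K : nzRingType) (m : nat -> K) : scalar (moment m).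
Proof.
move=> k p q; pose n := maxn (size p) (size q).
have le_n : (size (k *: p + q)%R <= n)%N.
  rewrite (leq_trans (size_polyD _ _)) // geq_max leq_maxr andbT.
  by rewrite (leq_trans (size_scale_leq _ _)) ?leq_maxl.
rewrite (momentE m le_n) !(@momentE _ m _ n) ?leq_maxl ?leq_maxr //.
rewrite mulr_sumr -big_split; apply: eq_bigr => i _ /=.
by rewrite coefD coefZ mulrDl mulrA.
Qed.
HB.instance Definition _ (K : nzRingType) (m : nat -> K) :=
  GRing.isLinear.Build K {poly K} K *%R (moment m) (moment_is_scalar m).

Lemma momentXn (K : nzRingType) (m : nat -> K) k : moment m 'X^k = m k.
Proof.
rewrite /moment size_polyXn big_ord_recr /= coefXn eqxx mul1r big1 ?add0r // => i _.
by rewrite coefXn ltn_eqF ?mul0r.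
Qed.

Lemma moment_mul (K : comNzRingType) (m : nat -> K) n (p q : {poly K}) :
  (size p <= n)%N -> (size q <= n)%N ->
  moment m (p * q) = \sum_(i < n) \sum_(j < n) p`_i * m (i + j)%N * q`_j.
Proof.
move=> le_p le_q.
rewrite -{1}[p]coefK -{1}[q]coefK !poly_def mulr_suml raddf_sum /=.
rewrite (big_ord_widen _ (fun i => moment m (p`_i *: 'X^i *
  (\sum_(j < size q) q`_j *: 'X^j))) le_p) big_mkcond.
apply: eq_bigr => i _ /=; case: ltnP => [_|/leq_sizeP->//]; last first.
  by rewrite big1 // => j _; rewrite !mul0r.
rewrite mulr_sumr raddf_sum /=.
rewrite (big_ord_widen _ (fun j => moment m (p`_i *: 'X^i * (q`_j *: 'X^j))) le_q).
rewrite big_mkcond.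
apply: eq_bigr => j _ /=; case: ltnP => [_|/leq_sizeP->//]; last by rewrite mulr0.
by rewrite -scalerAl -scalerAr -exprD !linearZ /= momentXn; ring.
Qed.

(** The top term only comes from multiplying by [(1 - 2 * b) *: 'X] the previous
    polynomial; everything else in the recurrence has smaller degree. *)
Lemma biorth_triangular (K : numFieldType) (b : K) i :
  (size (biorth b i) <= i.+1)%N /\ (biorth b i)`_i = (1 - 2 * b) ^+ i.
Proof.
have szZ (k : K) (p : {poly K}) : (size (k *: 'X * p)%R <= (size p).+1)%N.
  rewrite -scalerAl (leq_trans (size_scale_leq _ _)) // mulrC.
  by rewrite (leq_trans (size_polyMleq _ _)) // size_polyX addn2.
have szC (k : K) (p : {poly K}) : (size (k%:P * p)%R <= size p)%N.
  by rewrite mul_polyC size_scale_leq.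
have szD (p q : {poly K}) n :
    (size p <= n)%N -> (size q <= n)%N -> (size (p + q)%R <= n)%N.
  by move=> lp lq; rewrite (leq_trans (size_polyD _ _)) // geq_max lp lq.
have key k l n (p q r : {poly K}) : (size p <= n.+1)%N -> (size q <= n)%N ->
    (size r <= n)%N -> let t := (k%:P + (1 - 2 * b) *: 'X) * p
      - (l%:P + (1 - 2 * b) *: 'X) * q - r in
    (size t <= n.+2)%N /\ t`_n.+1 = (1 - 2 * b) * p`_n.
  move=> sp sq sr t; split.
    rewrite /t !mulrDl; apply: (szD); last by rewrite size_polyN ltnW // ltnW.
    apply: (szD); last rewrite size_polyN; apply: (szD).
    - by rewrite (leq_trans (szC _ _)) // ltnW.
    - by rewrite (leq_trans (szZ _ _)).
    - by rewrite (leq_trans (szC _ _)) // ltnW // ltnW.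
    - by rewrite (leq_trans (szZ _ _)) // ltnW.
  rewrite /t !mulrDl !coefB !coefD !mul_polyC -!scalerAl !coefZ !(coefXM) /=.
  rewrite [p`_n.+1]nth_default // [q`_n.+1]nth_default ?(leq_trans sq) //.
  by rewrite [q`_n]nth_default // [r`_n.+1]nth_default ?(leq_trans sr) //; ring.
elim/ltn_ind: i => -[|[|[|n]]] IHn.
- by rewrite size_poly1 coef1.
- split=> /=; last by rewrite coefD coefC coefZ coefX /= add0r mulr1 expr1.
  apply: szD; first by rewrite (leq_trans (size_polyC_leq1 _)).
  by rewrite (leq_trans (size_scale_leq _ _)) // size_polyX.
- have [sz1 p1] := IHn 1%N isT.
  have -> : biorth b 2 = ((3 * b)%:P + (1 - 2 * b) *: 'X) * biorth b 1
      - ((3 * b ^+ 2)%:P + (1 - 2 * b) *: 'X) * 1 - - (b ^+ 2)%:P.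
    by rewrite !(rmorphM, rmorphXn, rmorph_nat) mulr1 opprK.
  have := @key (3 * b) (3 * b ^+ 2) 1%N (biorth b 1) 1 (- (b ^+ 2)%:P) sz1.
  rewrite size_poly1 size_polyN size_polyC_leq1 p1 -exprS; exact.
have [sz2 p2] := IHn n.+2 (ltnSn _).
have [sz1 _] := IHn n.+1 (ltnW (ltnSn _)).
have [sz0 _] := IHn n (ltnW (ltnW (ltnSn _))).
have -> : biorth b n.+3 = ((3 * b)%:P + (1 - 2 * b) *: 'X) * biorth b n.+2
    - ((3 * b ^+ 2)%:P + (1 - 2 * b) *: 'X) * biorth b n.+1 - biorth b n.
  by rewrite biorthS3 !(rmorphM, rmorphXn, rmorph_nat).
have := @key (3 * b) (3 * b ^+ 2) n.+2 _ _ _ sz2 sz1 (leq_trans sz0 (leqnSn _)).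
by rewrite p2 -exprS.
Qed.

Lemma hatC1_0 : hatC1 0 = 2.
Proof.
rewrite /hatC1 /fps_divX /fps_scale /fps_sub /fps_binomial /gbinom /fps_one /=.
by rewrite big_ord_recr big_ord0 factS fact0 expr1 subr0 muln1 /=; field.
Qed.

(** Consecutive coefficients of [(1 - 9 x) ^ (2/3)] have a rational ratio; the
    factor 3 is absorbed by rescaling [x]. *)
Lemma hatC1_rec k : hatC1 k.+1 *+ k.+2 = 3 * (hatC1 k *+ (3 * k).+1).
Proof.
rewrite /hatC1 /fps_divX /fps_scale /fps_sub /fps_binomial /gbinom /fps_one /=.
rewrite big_ord_recr [in LHS]/= factS natrM.
set p := \prod_(i < k.+1) _; set f := k.+1`!%:R.
have f0 : f != 0 by rewrite pnatr_eq0 -lt0n fact_gt0.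
have k0 : k.+2%:R != 0 :> rat by rewrite pnatr_eq0.
rewrite -[_ *+ k.+2]mulr_natr -[_ *+ (3 * k)%N.+1]mulr_natr exprS.
have -> : (3 * k)%N.+1%:R = 3 * k.+1%:R - 2 :> rat.
  by rewrite -[(3 * k)%N.+1]addn1 natrD natrM -[k.+1]addn1 natrD; ring.
field.
by rewrite -[_`!%:R]/f f0 -natrD k0.
Qed.

Lemma prod_expr_ord (K : comNzRingType) (x : K) n :
  \prod_(i < n) x ^+ i = x ^+ 'C(n, 2).
Proof.
by rewrite -bin2_sum big_mkord; elim/big_rec2: _ => // i y z _ ->; rewrite exprD.
Qed.

Lemma hankel_scale (K : comNzRingType) (m : nat -> K) (x : K) n :
  \det (\matrix_(i < n, j < n) (x ^+ (i + j) * m (i + j)%N)) =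
  x ^+ 'C(n, 2) * x ^+ 'C(n, 2) * \det (\matrix_(i < n, j < n) m (i + j)%N).
Proof.
pose d : 'rV[K]_n := \row_i x ^+ i.
have -> : \matrix_(i < n, j < n) (x ^+ (i + j) * m (i + j)%N) =
    diag_mx d *m (\matrix_(i < n, j < n) m (i + j)%N) *m diag_mx d.
  by apply/matrixP => i j; rewrite mul_mx_diag mul_diag_mx !mxE exprD; ring.
have detd : \det (diag_mx d) = x ^+ 'C(n, 2).
  by rewrite det_diag -prod_expr_ord; apply: eq_bigr => i _; rewrite mxE.
by rewrite !det_mulmx detd mulrAC.
Qed.

(** The biorthogonal polynomials give the triangular factors, with diagonals
    the powers of [1 - 2 b] and of [1 - 2 (1 - b)]; their product is
    [- (1 - 2 b) ^+ 2 = 3]. *)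
Lemma det_biorth (K : numFieldType) (m : nat -> K) (b : K) n :
  b ^+ 2 = b - 1 -> m 0%N = 2 ->
  (forall k, m k.+1 *+ k.+2 = m k *+ (3 * k).+1) ->
  \det (\matrix_(i < n, j < n) ((i == j)%:R + 'C(i + j, i)%:R : K)) =
  3 ^+ 'C(n, 2) * \det (\matrix_(i < n, j < n) m (i + j)%N).
Proof.
move=> b2 m0 mrec.
pose L : {scalar {poly K}} := moment m.
have L1 : L 1 = 2 by rewrite -(expr0 'X) [L _]momentXn.
have Lrec k : L 'X^(k.+1) *+ k.+2 = L 'X^k *+ (3 * k).+1.
  by rewrite ![L _]momentXn mrec.
pose A c : 'M[K]_n := \matrix_(i, j) (biorth c i)`_j.
have -> : \matrix_(i < n, j < n) ((i == j)%:R + 'C(i + j, i)%:R : K) =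
    A b *m (\matrix_(i < n, j < n) m (i + j)%N) *m (A (1 - b))^T.
  apply/matrixP => i j; rewrite !mxE -(biorthogonal L1 Lrec b2).
  have le_n (c : K) (k : 'I_n) : (size (biorth c k) <= n)%N.
    by have [/leq_trans-> //] := biorth_triangular c k.
  rewrite [L _](moment_mul m (le_n b i) (le_n (1 - b) j)) exchange_big /=.
  apply: eq_bigr => k _; rewrite !mxE mulr_suml; apply: eq_bigr => l _.
  by rewrite !mxE.
have detA c : \det (A c) = (1 - 2 * c) ^+ 'C(n, 2).
  rewrite det_trig; last first.
    apply/is_trig_mxP => i j lt_ij; rewrite mxE nth_default //.
    by have [/leq_trans->] := biorth_triangular c i.
  rewrite -prod_expr_ord; apply: eq_bigr => i _.
  by rewrite mxE; have [_ ->] := biorth_triangular c i.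
rewrite !det_mulmx det_tr !detA mulrAC -exprMn; congr (_ ^+ _ * _).
transitivity (3 - 4 * (b ^+ 2 - (b - 1))); first by ring.
by rewrite b2 subrr mulr0 subr0.
Qed.

(** The sixth roots of unity are not rational, so the factorization takes place
    over the algebraic numbers; the identity itself descends. *)
Lemma hankel_hatC1 n :
  \det (\matrix_(i < n, j < n) ((i == j)%:R + 'C(i + j, i)%:R)) =
  3 ^- 'C(n, 2) * hankel n hatC1 :> rat.
Proof.
apply: (fmorph_inj (ratr : rat -> algC)).
pose m k : algC := ratr (hatC1 k / 3 ^+ k).
pose b : algC := (1 + sqrtC (- 3)) / 2.
have b2 : b ^+ 2 = b - 1.
  have r2 : sqrtC (- 3) ^+ 2 = - 3 :> algC by apply: sqrtCK.
  by rewrite /b expr_div_n sqrrD r2; field.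
have m0 : m 0%N = 2 by rewrite /m hatC1_0 divr1 ratr_nat.
have mrec k : m k.+1 *+ k.+2 = m k *+ (3 * k).+1.
  rewrite /m -!raddfMn; congr (ratr _).
  rewrite -[LHS]mulrnAl -[RHS]mulrnAl hatC1_rec exprS invfM mulrACA.
  by rewrite divff ?mul1r.
transitivity (\det (\matrix_(i < n, j < n) ((i == j)%:R + 'C(i + j, i)%:R : algC))).
  rewrite -det_map_mx; congr (\det _).
  by apply/matrixP => i j; rewrite !mxE raddfD /= !ratr_nat.
rewrite (det_biorth n b2 m0 mrec).
have -> : \matrix_(i < n, j < n) m (i + j)%N =
    map_mx ratr (\matrix_(i < n, j < n) (3^-1 ^+ (i + j) * hatC1 (i + j)%N)).
  by apply/matrixP => i j; rewrite !mxE /m exprVn mulrC.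
rewrite det_map_mx hankel_scale -[3]ratr_nat -rmorphXn -rmorphM; congr ratr.
rewrite !mulrA -exprMn divff ?expr1n ?mul1r ?exprVn //.
Qed.

(** * Sums of determinants *)

Lemma det_row_sum (R : comNzRingType) n (T : finType) (Q : 'I_n -> pred T)
    (F : 'I_n -> T -> 'I_n -> R) :
  \det (\matrix_(i, j) \sum_(a | Q i a) F i a j) =
  \sum_(f : {ffun 'I_n -> T} | [forall i, Q i (f i)])
    \det (\matrix_(i, j) F i (f i) j).
Proof.
rewrite /determinant exchange_big /=; apply: eq_bigr => s _.
rewrite -mulr_sumr; congr (_ * _).
rewrite (eq_bigr (fun i => \sum_(a | Q i a) F i a (s i))); last first.
  by move=> i _; rewrite mxE.
rewrite bigA_distr_big_dep; apply: eq_big => [f|f _].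
  by apply/familyP/forallP => Qf i; have := Qf i.
by apply: eq_bigr => i _; rewrite mxE.
Qed.

Lemma det_col_sum (R : comNzRingType) n (T : finType) (Q : 'I_n -> pred T)
    (F : 'I_n -> 'I_n -> T -> R) :
  \det (\matrix_(i, j) \sum_(b | Q j b) F i j b) =
  \sum_(g : {ffun 'I_n -> T} | [forall j, Q j (g j)])
    \det (\matrix_(i, j) F i j (g j)).
Proof.
rewrite -det_tr.
have -> : (\matrix_(i, j) \sum_(b | Q j b) F i j b)^T =
    \matrix_(j, i) \sum_(b | Q j b) F i j b.
  by apply/matrixP => i j; rewrite !mxE.
rewrite (det_row_sum Q (fun j b i => F i j b)); apply: eq_bigr => g _.
by rewrite -det_tr; congr (\det _); apply/matrixP => i j; rewrite !mxE.
Qed.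

Lemma det_zero_row (R : comNzRingType) n (A : 'M[R]_n) i :
  (forall j, A i j = 0) -> \det A = 0.
Proof. by move=> A0; rewrite (expand_det_row _ i) big1 // => j _; rewrite A0 mul0r. Qed.

Lemma det_zero_col (R : comNzRingType) n (A : 'M[R]_n) j :
  (forall i, A i j = 0) -> \det A = 0.
Proof. by move=> A0; rewrite (expand_det_col _ j) big1 // => i _; rewrite A0 mul0r. Qed.

Lemma det_conj_perm (R : comNzRingType) n (A : 'M[R]_n) (s : 'S_n) :
  \det (\matrix_(i, j) A (s i) (s j)) = \det A.
Proof.
have -> : \matrix_(i, j) A (s i) (s j) = col_perm s (row_perm s A).
  by apply/matrixP => i j; rewrite !mxE.
rewrite col_permE row_permE !det_mulmx !det_perm odd_permV mulrAC.
by rewrite -signr_addb addbb mul1r.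
Qed.

Definition principal_mx (R : comNzRingType) n (A : 'M[R]_n) (S : {set 'I_n}) :=
  \matrix_(i, j) (if (i \in S) && (j \in S) then A i j else (i == j)%:R).

(** Each permutation contributes to the minor of [S] only if it fixes the
    complement of [S] pointwise; then it preserves [S], so the rows taken from
    [A] only meet columns in [S]. *)
Lemma det_add1 (R : comNzRingType) n (A : 'M[R]_n) :
  \det (1%:M + A) = \sum_(S : {set 'I_n}) \det (principal_mx A S).
Proof.
rewrite /determinant exchange_big /=; apply: eq_bigr => s _.
rewrite -mulr_sumr; congr (_ * _).
rewrite (eq_bigr (fun i => A i (s i) + (i == s i)%:R)); last first.
  by move=> i _; rewrite !mxE addrC.
rewrite bigA_distr; apply: eq_bigr => S _.
have [fixS | /forallPn[i]] := boolP [forall i, (i \notin S) ==> (i == s i)].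
  apply: eq_bigr => i _; rewrite mxE; case: ifP => iS //=.
  case: ifP => // /negbT siS.
  move/forallP: fixS => /(_ (s i)); rewrite siS => /eqP/perm_inj/esym si.
  by rewrite si iS in siS.
rewrite negb_imply => /andP[iS si].
rewrite (bigD1 i) //= (negPf iS) (negPf si) mul0r.
by rewrite (bigD1 i) //= mxE (negPf iS) (negPf si) mul0r.
Qed.

(** * Pairs of strict partitions *)

Section StrictPartitions.
Variable n : nat.
Local Notation state := {ffun 'I_n -> 'I_n.+1}.
Implicit Types f g : state.

(** A strict partition with at most [n] parts, padded with zeros: positive values
    strictly decrease. *)
Definition strict_part f :=
  [forall i : 'I_n, forall j : 'I_n,
     (i < j)%N ==> ((f j == 0%N :> nat) || (f j < f i)%N)].

Definition drop01 a b := (b == a) || (b.+1 == a).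

Definition erode f g := [forall i, drop01 (f i) (g i)].

Definition same_length f g :=
  [forall i, (f i == 0%N :> nat) == (g i == 0%N :> nat)].

Lemma strict_partP f :
  reflect (forall i j : 'I_n, (i < j)%N -> f j = 0%N :> nat \/ (f j < f i)%N)
          (strict_part f).
Proof.
apply: (iffP forallP) => [sf i j lt_ij | sf i].
  by have /forallP/(_ j)/implyP/(_ lt_ij)/orP[/eqP|] := sf i; [left | right].
apply/forallP => j; apply/implyP => /sf[->|->] //.
exact: orbT.
Qed.

Lemma strict_part_erode f g (i j : 'I_n) : strict_part f -> erode f g ->
  (i < j)%N -> [\/ g j = 0%N :> nat, (g j < g i)%N | g i = g j /\ g j != 0%N :> nat].
Proof.
move=> /strict_partP sf /forallP ef lt_ij.
have := sf i j lt_ij; have := ef i; have := ef j; rewrite /drop01 => ej ei sij.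
have [->|gj0] := eqVneq (g j : nat) 0%N; first by constructor 1.
have [lt_g|le_g] := ltnP (g j) (g i); first by constructor 2.
constructor 3; split=> //; apply: val_inj => /=; lia.
Qed.

Variable R : comNzRingType.

Definition pascal i a : R := if a is a'.+1 then 'C(i, a')%:R else 0.

Definition gram d a b : R := \sum_(i < d) pascal i a * pascal i b.

(** [gram] vanishes as soon as an argument is 0, so the extra 1 makes the
    matrix [link_mx] block diagonal, with an identity block in the places where
    both partitions have run out of parts.  This allows all determinants to have
    the same size, whatever the number of parts. *)
Definition link d (diag : bool) a b : R :=
  gram d a b + [&& diag, a == 0%N & b == 0%N]%:R.

Definition link_mx d f g : 'M[R]_n := \matrix_(i, j) link d (i == j) (f i) (g j).

Lemma pascalS i a : pascal i.+1 a.+1 = pascal i a.+1 + pascal i a.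
Proof. by case: a => [|a] /=; rewrite ?bin0 ?addr0 // binS natrD. Qed.

Lemma gram0l d b : gram d 0 b = 0.
Proof. by rewrite /gram big1 // => i _; rewrite mul0r. Qed.
Lemma gram0r d a : gram d a 0 = 0.
Proof. by rewrite /gram big1 // => i _; rewrite mulr0. Qed.

(** Pascal's rule in both arguments; the isolated term is the row 0 of Pascal's
    triangle, and accounts for the pairs of parts that vanish together. *)
Lemma gramS d a b : gram d.+1 a.+1 b.+1 =
  ((a == 0%N) && (b == 0%N))%:R
  + (gram d a.+1 b.+1 + gram d a b.+1 + (gram d a.+1 b + gram d a b)).
Proof.
rewrite /gram big_ord_recl /= !bin0n -natrM mulnb; congr (_ + _).
rewrite -!big_split; apply: eq_bigr => i _ /=.
by rewrite -[X in X * _]/(pascal i.+1 a.+1) -[X in _ * X]/(pascal i.+1 b.+1) !pascalS;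
  ring.
Qed.

Lemma sum_drop01 (F : nat -> R) (a : 'I_n.+1) :
  \sum_(b : 'I_n.+1 | drop01 a b) F b =
  if (a : nat) is a'.+1 then F a'.+1 + F a' else F 0%N.
Proof.
case: a => -[|a] lt_a /=.
  rewrite (bigD1 ord0) //= big1 ?addr0 // => b.
  by rewrite /drop01 orbF => /andP[/eqP b0] /eqP[]; apply: val_inj.
rewrite (bigD1 (Ordinal lt_a)) /=; last by rewrite /drop01 eqxx.
rewrite (bigD1 (Ordinal (ltnW lt_a))) /=; last first.
  by rewrite /drop01 eqxx orbT -val_eqE /= neq_ltn ltnSn.
rewrite big1 ?addr0 // => b; rewrite /drop01 -!val_eqE /=; lia.
Qed.

(** Every entry of [link_mx d.+1] is a sum over the independent successors of the
    two parts.  When both parts are 1 the term where both drop to 0 must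
    contribute 1; off the diagonal this case does not occur, as only the last
    part of a strict partition can be 1 and both have the same length. *)
Lemma link_rec d f g i j : strict_part f -> strict_part g -> same_length f g ->
  link d.+1 (i == j) (f i) (g j) =
  \sum_(a : 'I_n.+1 | drop01 (f i) a) \sum_(b : 'I_n.+1 | drop01 (g j) b)
     link d (i == j) a b.
Proof.
move=> /strict_partP sf /strict_partP sg /forallP len.
pose F x := if (g j : nat) is y.+1 then link d (i == j) x y.+1 + link d (i == j) x y
  else link d (i == j) x 0%N.
rewrite (eq_bigr (fun a : 'I_n.+1 => F a)); last first.
  by move=> a _; rewrite (sum_drop01 (link d (i == j) a)).
rewrite (sum_drop01 F) /F /link.
have fg0 : i != j -> ((f i == 1%N :> nat) && (g j == 1%N :> nat)) = false.
  rewrite -val_eqE neq_ltn; have := len i; have := len j.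
  by move=> lj li /orP[/sf|/sg]; move: lj li; lia.
have := len i; move: fg0; have [<-|ne_ij] /= := eqVneq i j.
  move=> _; case: (f i : nat) => [|a]; case: (g i : nat) => [|b] //= _.
    by rewrite !gram0l.
  rewrite gramS; case: a b => [|a] [|b] /=; rewrite ?addr0 ?add0r //; ring.
move=> fg0 _; rewrite !addr0; move: (fg0 isT).
case: (f i : nat) => [|a]; case: (g j : nat) => [|b] //=; rewrite ?gram0l ?gram0r ?addr0 //.
by rewrite !eqSS => e; rewrite gramS e add0r; ring.
Qed.

(** Multilinear expansion of [link_rec] in rows and columns.  A successor of a
    strict partition fails to be strict only by having two equal positive parts,
    hence two equal rows or columns; successors of different lengths produce
    a zero row or column. *)
Lemma link_mx_rec d f g : strict_part f -> strict_part g -> same_length f g ->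
  \det (link_mx d.+1 f g) =
  \sum_(f' | erode f f' && strict_part f')
    \sum_(g' | [&& erode g g', strict_part g' & same_length f' g'])
      \det (link_mx d f' g').
Proof.
move=> sf sg len.
have -> : link_mx d.+1 f g = \matrix_(i, j)
    \sum_(a : 'I_n.+1 | drop01 (f i) a) \sum_(b : 'I_n.+1 | drop01 (g j) b)
       link d (i == j) a b.
  by apply/matrixP => i j; rewrite !mxE link_rec.
rewrite (det_row_sum (fun i (a : 'I_n.+1) => drop01 (f i) a) (fun i a j =>
   \sum_(b : 'I_n.+1 | drop01 (g j) b) link d (i == j) a b)).
rewrite [RHS]big_mkcondr; apply: eq_bigr => f' ef'.
rewrite (det_col_sum (fun j (b : 'I_n.+1) => drop01 (g j) b) (fun i j b =>
   link d (i == j) (f' i) b)).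
rewrite (eq_bigr (fun g' => \det (link_mx d f' g'))) //.
have [sf' | nsf'] := boolP (strict_part f').
  rewrite big_mkcondr; apply: eq_bigr => g' eg'.
  have [sg' | nsg'] := boolP (strict_part g').
    have [//|/forallPn[i neq_i]] := boolP (same_length f' g').
    have [fi0 | fi0] := eqVneq (f' i : nat) 0%N.
      apply: (@det_zero_row _ _ _ i) => j; rewrite mxE /link fi0 gram0l add0r /=.
      case: eqVneq => //= <-; move: neq_i; rewrite fi0 eqxx.
      by case: (g' i == 0%N :> nat).
    apply: (@det_zero_col _ _ _ i) => j; rewrite mxE /link.
    have gi0 : g' i = 0%N :> nat by apply/eqP; move: neq_i; rewrite (negPf fi0);
        case: (g' i == 0%N :> nat).
    by rewrite gi0 gram0r add0r; case: eqVneq => //= ->; rewrite (negPf fi0).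
  case/forallPn: nsg' => i /forallPn[j]; rewrite negb_imply => /andP[lt_ij].
  rewrite negb_or -leqNgt => /andP[gj0 le_g].
  have [gj|lt_g|[gij _]] := strict_part_erode sg eg' lt_ij.
  - by rewrite gj in gj0.
  - by rewrite ltnNge le_g in lt_g.
  rewrite -det_tr; apply: (@determinant_alternate _ _ _ i j).
    by rewrite -val_eqE neq_ltn lt_ij.
  by move=> k; rewrite !mxE /link gij (negPf gj0) !andbF.
rewrite big1 // => g' _.
case/forallPn: nsf' => i /forallPn[j]; rewrite negb_imply => /andP[lt_ij].
rewrite negb_or -leqNgt => /andP[fj0 le_f].
have [fj|lt_f|[fij _]] := strict_part_erode sf ef' lt_ij.
- by rewrite fj in fj0.
- by rewrite ltnNge le_f in lt_f.
apply: (@determinant_alternate _ _ _ i j).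
  by rewrite -val_eqE neq_ltn lt_ij.
by move=> k; rewrite !mxE /link fij (negPf fj0) !andbF.
Qed.

End StrictPartitions.

(** * Chains of pairs of strict partitions *)

Lemma card_paths_rec (T : finType) (e : rel T) (P : pred T) d x :
  #|[set t : d.+1.-tuple T | path e x t && P (last x t)]| =
  (\sum_(y | e x y) #|[set t : d.-tuple T | path e y t && P (last y t)]|)%N.
Proof.
rewrite cardsE -sum1_card.
pose h (p : T * d.-tuple T) : d.+1.-tuple T := cons_tuple p.1 p.2.
rewrite (reindex h) /=; last first.
  exists (fun t => (thead t, behead_tuple t)) => [[y t] _|t _] /=.
    by congr pair; apply: val_inj.
  by rewrite /h /= [RHS]tuple_eta; apply: val_inj.
rewrite (eq_bigl (fun p : T * d.-tuple T =>
   e x p.1 && (path e p.1 p.2 && P (last p.1 p.2)))); last first.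
  by move=> [y t]; rewrite /= unfold_in /= -andbA.
rewrite -(pair_big_dep (e x) (fun y (t : d.-tuple T) => path e y t && P (last y t))
   (fun _ _ => 1%N)) /=.
by apply: eq_bigr => y _; rewrite sum1_card cardsE.
Qed.

Section Chains.
Variable n : nat.
Local Notation state := {ffun 'I_n -> 'I_n.+1}.

Definition empty_state : state := [ffun=> ord0].

Definition chain_step (x y : state * state) :=
  [&& erode x.1 y.1, strict_part y.1, erode x.2 y.2, strict_part y.2
    & same_length y.1 y.2].

Definition chains d (x : state * state) :=
  [set t : d.-tuple (state * state) |
     path chain_step x t && (last x t == (empty_state, empty_state))].

Variable R : comNzRingType.

Lemma link_mx0 (f g : state) :
  \det (link_mx R 0 f g) = ((f, g) == (empty_state, empty_state))%:R.
Proof.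
have link0 (h k : state) i j : link_mx R 0 h k i j =
    [&& i == j, h i == 0%N :> nat & k j == 0%N :> nat]%:R.
  by rewrite mxE /link /gram big_ord0 add0r.
case: eqP => [[-> ->]|/eqP neq].
  rewrite -[RHS](det1 R n); congr (\det _); apply/matrixP => i j.
  by rewrite link0 !mxE !ffunE /= !andbT.
have empty_inj (h : state) : (forall i, h i = 0%N :> nat) -> h = empty_state.
  by move=> h0; apply/ffunP => i; apply: val_inj; rewrite ffunE; apply: h0.
have [/forallP f0|/forallPn[i fi]] := boolP [forall i, f i == 0%N :> nat].
  have [/forallP g0|/forallPn[i gi]] := boolP [forall i, g i == 0%N :> nat].
    case/eqP: neq; congr pair; apply: empty_inj => i; apply/eqP.
      exact: f0.
    exact: g0.
  by apply: (@det_zero_col _ _ _ i) => j; rewrite link0 (negPf gi) !andbF.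
by apply: (@det_zero_row _ _ _ i) => j; rewrite link0 (negPf fi) andbF.
Qed.

(** Chains and determinants satisfy the same recursion, [card_paths_rec] and
    [link_mx_rec]. *)
Lemma card_chains d (f g : state) :
  strict_part f -> strict_part g -> same_length f g ->
  #|chains d (f, g)|%:R = \det (link_mx R d f g).
Proof.
elim: d f g => [|d IHd] f g sf sg len.
  rewrite link_mx0; have -> : chains 0 (f, g) =
      if (f, g) == (empty_state, empty_state) then setT else set0.
    by apply/setP => t; rewrite [t]tuple0 inE /=; case: ifP; rewrite inE.
  by case: ifP; rewrite ?cardsT ?card_tuple ?cards0.
rewrite link_mx_rec // [chains _ _]/chains.
rewrite (card_paths_rec _ (pred1 (empty_state, empty_state))) natr_sum pair_big_dep /=.
apply: eq_big => [[f' g']|[f' g'] /=]; first by rewrite /chain_step /=; do !bool_congr.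
by move=> /and5P[_ sf' _ sg' len']; rewrite -IHd.
Qed.

End Chains.

(** * Closing up the chains *)

Section ClosedChains.
Variables (R : comNzRingType) (n : nat).
Local Notation state := {ffun 'I_n -> 'I_n.+1}.

(** Sets of positions and strict partitions correspond to each other; this turns
    the sum over strict partitions into the sum of principal minors. *)
Definition parts_of (S : {set 'I_n}) : seq nat := rev [seq (val i).+1 | i <- enum S].

Definition part_of_set (S : {set 'I_n}) : state :=
  [ffun i : 'I_n => inord (nth 0%N (parts_of S) i)].

Definition support (f : state) : {set 'I_n} :=
  [set i : 'I_n | [exists k, f k == i.+1 :> nat]].

Lemma size_parts_of S : size (parts_of S) = #|S|.
Proof. by rewrite size_rev size_map cardE. Qed.

Lemma mem_parts_of S a : (a \in parts_of S) = [exists i in S, a == i.+1 :> nat].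
Proof.
rewrite mem_rev; apply/mapP/exists_inP => [[i iS ->]|[i iS /eqP->]]; exists i => //.
  by rewrite -mem_enum.
by rewrite mem_enum.
Qed.

Lemma parts_of_sorted S : sorted gtn (parts_of S).
Proof.
rewrite rev_sorted (map_comp succn val) sorted_map.
have : sorted ltn [seq val i | i <- enum S].
  rewrite -[enum _](eq_filter (mem_enum _)) -(eq_filter (mem_map val_inj _)).
  by rewrite -filter_map (sorted_filter ltn_trans) // unlock val_ord_enum iota_ltn_sorted.
by apply: sub_sorted => a b.
Qed.

Lemma part_of_setE S i : part_of_set S i = nth 0%N (parts_of S) i :> nat.
Proof.
rewrite ffunE inordK //; case: (ltnP i (size (parts_of S))) => [lt_i|?].
  have := mem_nth 0%N lt_i; rewrite mem_parts_of => /exists_inP[k _ /eqP->].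
  by rewrite ltnS ltn_ord.
by rewrite nth_default.
Qed.

Lemma part_of_set_strict S : strict_part (part_of_set S).
Proof.
apply/strict_partP => i j lt_ij; rewrite !part_of_setE.
have [le_j|lt_j] := leqP (size (parts_of S)) j; first by left; rewrite nth_default.
have gtn_trans : transitive gtn by move=> x y z /= ? ?; apply: ltn_trans; eassumption.
right; apply: (sorted_ltn_nth gtn_trans 0%N (parts_of_sorted S)) => //.
by rewrite inE (ltn_trans lt_ij).
Qed.

Lemma part_of_setK : cancel part_of_set support.
Proof.
move=> S; apply/setP => i; rewrite inE; apply/existsP/idP => [[k]|iS].
  rewrite part_of_setE => /eqP ki; have : nth 0%N (parts_of S) k \in parts_of S.
    by apply: mem_nth; rewrite ltnNge; apply/negP => ?; rewrite nth_default in ki.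
  by rewrite ki mem_parts_of => /exists_inP[j jS /eqP[/val_inj->]].
have mem_i : i.+1 \in parts_of S by rewrite mem_parts_of; apply/exists_inP; exists i.
have lt_n : (index i.+1 (parts_of S) < n)%N.
  apply: (@leq_trans (size (parts_of S))); first by rewrite index_mem.
  by rewrite size_parts_of -[n in (_ <= n)%N]card_ord max_card.
by exists (Ordinal lt_n); rewrite part_of_setE nth_index.
Qed.

Let follows a b := (b == 0%N) || (b < a)%N.

(** In a padded strict partition all zeros come last, so removing them does not
    move the other entries. *)
Lemma nth_filter_pos s i : sorted follows s ->
  nth 0%N [seq x <- s | 0 < x]%N i = nth 0%N s i.
Proof.
have tr : transitive follows by rewrite /follows => a b c; lia.
elim: s i => //= x s IHs i path_s; case: posnP => [x0|x_gt0]; last first.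
  by case: i => //= i; rewrite IHs // (path_sorted path_s).
have s0 : all (pred1 0%N) s.
  by have := order_path_min tr path_s; apply: sub_all => a; rewrite /follows x0 /= ltn0 orbF.
have -> : [seq y <- s | 0 < y]%N = [::].
  by apply/eqP; rewrite -[_ == _]negbK -has_filter -all_predC; apply: sub_all s0 => a /eqP->.
rewrite nth_nil x0; case: i => //= i.
have [lt_i|le_i] := ltnP i (size s); last by rewrite nth_default.
by have /eqP-> := all_nthP 0%N s0 i lt_i.
Qed.

Lemma supportK f : strict_part f -> part_of_set (support f) = f.
Proof.
move=> /strict_partP sf; pose c := [seq val (f i) | i <- enum 'I_n].
have size_c : size c = n by rewrite size_map size_enum_ord.
have nth_c (i : 'I_n) : nth 0%N c i = f i.
  by rewrite (nth_map i) ?size_enum_ord // nth_ord_enum.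
have tr : transitive follows by rewrite /follows => x y z; lia.
have sc : sorted follows c.
  apply/(sortedP 0%N) => i; rewrite size_c => lt_i.
  rewrite -[i.+1]/(val (Ordinal lt_i)) -[i]/(val (Ordinal (ltnW lt_i))) !nth_c /follows.
  by have [->|->] := sf (Ordinal (ltnW lt_i)) (Ordinal lt_i) (ltnSn _); rewrite ?orbT.
have cE : parts_of (support f) = [seq x <- c | 0 < x]%N.
  apply: (@irr_sorted_eq _ gtn).
  - by move=> x y z /= ? ?; apply: ltn_trans; eassumption.
  - by move=> x; rewrite /= ltnn.
  - exact: parts_of_sorted.
  - have := sorted_filter tr (ltn 0) sc.
    apply: (@sub_in_sorted _ (ltn 0)); last exact: filter_all.
    by move=> x y; rewrite !inE /follows /=; lia.
  move=> x; rewrite mem_parts_of mem_filter.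
  apply/exists_inP/andP => [[i]|[x_gt0 /mapP[k _ xE]]].
    rewrite inE => /existsP[k /eqP fk] /eqP->; split=> //.
    by apply/mapP; exists k; rewrite ?mem_enum.
  have lt_x : (x.-1 < n)%N by rewrite -ltnS prednK // xE ltn_ord.
  exists (Ordinal lt_x); last by rewrite /= prednK.
  by rewrite inE; apply/existsP; exists k; rewrite /= prednK // xE.
apply/ffunP => i; apply: val_inj; rewrite [LHS]part_of_setE.
by rewrite cE nth_filter_pos // nth_c.
Qed.

Definition gram_mx d : 'M[R]_n := \matrix_(i, j) gram R d i.+1 j.+1.

(** The two matrices differ by the permutation that lists the elements of [S] in
    decreasing order, followed by the complement of [S]. *)
Lemma link_part_of_set d S :
  \det (link_mx R d (part_of_set S) (part_of_set S)) =
  \det (principal_mx (gram_mx d) S).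
Proof.
pose s := rev (enum S) ++ enum (~: S).
have size_s : size s = n.
  by rewrite size_cat size_rev -!cardE cardsC card_ord.
have uniq_s : uniq s.
  rewrite cat_uniq rev_uniq !enum_uniq andbT /=; apply/hasPn => i.
  by rewrite mem_enum mem_rev mem_enum inE.
pose t (i : 'I_n) := nth i s i.
have t_inj : injective t.
  move=> i j; rewrite /t (set_nth_default i) ?size_s // => /eqP.
  by rewrite nth_uniq ?size_s // => /eqP/val_inj.
rewrite -(det_conj_perm (principal_mx _ _) (perm t_inj)); congr (\det _).
have tE i : part_of_set S i = (if t i \in S then (t i).+1 else 0)%N :> nat.
  rewrite part_of_setE /t nth_cat size_rev -cardE.
  have [lt_i|le_i] := ltnP i #|S|.
    rewrite -mem_enum -mem_rev mem_nth ?size_rev -?cardE //.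
    by rewrite /parts_of -map_rev (nth_map i) // size_rev -cardE.
  rewrite nth_default ?size_parts_of // ifN // -in_setC -mem_enum mem_nth //.
  by rewrite -cardE ltn_subLR // cardsC card_ord.
apply/matrixP => i j; rewrite !mxE !permE !tE (inj_eq t_inj) /link.
case: (boolP (t i \in S)) => [iS|iS]; case: (boolP (t j \in S)) => [jS|jS] /=.
- by rewrite andbF addr0.
- by rewrite gram0r add0r andbF; case: eqVneq iS jS => // -> ->.
- by rewrite gram0l add0r !andbF; case: eqVneq iS jS => // -> /negPf->.
- by rewrite gram0l add0r !andbT.
Qed.

Lemma sum_link_strict d :
  \sum_(f : state | strict_part f) \det (link_mx R d f f) = \det (1%:M + gram_mx d).
Proof.
rewrite det_add1 (reindex_onto part_of_set support) /=; last exact: supportK.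
apply: eq_big => [S|S _]; first by rewrite part_of_set_strict part_of_setK eqxx.
exact: link_part_of_set.
Qed.

Lemma sum_bin_bin i j : (i < n)%N ->
  (\sum_(k < n) 'C(i, k) * 'C(j, k) = 'C(i + j, i))%N.
Proof.
move=> lt_i; rewrite addnC -binomial.Vandermonde.
rewrite (big_ord_widen n (fun k => 'C(j, k) * 'C(i, i - k))%N lt_i) [RHS]big_mkcond.
apply: eq_bigr => k _; case: ltnP => [le_ki|lt_ik]; last by rewrite bin_small.
by rewrite mulnC bin_sub.
Qed.

(** [gram_mx n] is [U^T *m U] for Pascal's triangle [U], which has determinant 1;
    conjugating by [U] exchanges the two factors. *)
Lemma det_gram_pascal :
  \det (1%:M + gram_mx n) = \det (\matrix_(i < n, j < n) ((i == j)%:R + 'C(i + j, i)%:R : R)).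
Proof.
pose U : 'M[R]_n := \matrix_(i, k) 'C(i, k)%:R.
have detU : \det U = 1.
  rewrite det_trig; first by rewrite big1 // => i _; rewrite mxE binn.
  by apply/is_trig_mxP => i j lt_ij; rewrite mxE bin_small.
have -> : gram_mx n = U^T *m U.
  apply/matrixP => i j; rewrite !mxE; apply: eq_bigr => k _.
  by rewrite !mxE.
have -> : \matrix_(i < n, j < n) ((i == j)%:R + 'C(i + j, i)%:R : R) = 1%:M + U *m U^T.
  apply/matrixP => i j; rewrite !mxE -sum_bin_bin // natr_sum; congr (_ + _).
  by apply: eq_bigr => k _; rewrite !mxE natrM.
have comm : U *m (1%:M + U^T *m U) = (1%:M + U *m U^T) *m U.
  by rewrite mulmxDr mulmxDl mulmx1 mul1mx mulmxA.
by have := congr1 determinant comm; rewrite !det_mulmx detU mul1r mulr1.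
Qed.

End ClosedChains.

(** * Plane partitions from coherent families of rows *)

Section RowData.
Variable n : nat.

(** The conditions satisfied by the lengths [lam d k] of the diagonals
    [(k + r, k + r + d, k)] and [mu d k] of the diagonals [(k + r + d, k + r, k)]
    of a cyclically symmetric plane partition.  The two families meet where
    [d = 0], and where [r = 0] by the cyclic symmetry. *)
Record coherent (lam mu : nat -> nat -> nat) : Prop := Coherent {
  coh_strictl : forall d k l, (k < l)%N -> lam d l = 0%N \/ (lam d l < lam d k)%N;
  coh_strictr : forall d k l, (k < l)%N -> mu d l = 0%N \/ (mu d l < mu d k)%N;
  coh_dropl : forall d k, drop01 (lam d k) (lam d.+1 k);
  coh_dropr : forall d k, drop01 (mu d k) (mu d.+1 k);
  coh_length : forall d k, (lam d k == 0%N) = (mu d k == 0%N);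
  coh_last : forall k, lam n k = 0%N;
  coh_first : forall k, lam 0 k = mu 0 k
}.

Section Member.
Variables lam mu : nat -> nat -> nat.

(** Membership of a point whose least coordinate is the last one. *)
Definition wedge i j k :=
  if (i <= j)%N then (i - k < lam (j - i) k)%N else (j - k < mu (i - j) k)%N.

(** The cyclic rotation that makes the last coordinate minimal need not be
    unique; taking all of them makes cyclic symmetry evident, and [member_wedge]
    shows that they agree. *)
Definition member i j k :=
  [|| [&& k <= i, k <= j & wedge i j k], [&& i <= j, i <= k & wedge j k i]
    | [&& j <= k, j <= i & wedge k i j]]%N.

Lemma member_cyc i j k : member i j k = member j k i.
Proof. by rewrite /member orbC -orbA. Qed.

Hypothesis coh : coherent lam mu.

Lemma member_wedge i j k : (k <= i)%N -> (k <= j)%N -> member i j k = wedge i j k.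
Proof.
move=> le_ki le_kj; rewrite /member le_ki le_kj /=; apply: orb_idr.
case/orP=> /and3P[le1 le2].
  have -> : i = k by lia.
  rewrite /wedge subnn le_kj; move: le_kj; rewrite leq_eqVlt => /orP[/eqP<-|lt_kj].
    by rewrite leqnn !subnn.
  by rewrite [(j <= k)%N]leqNgt lt_kj /= !lt0n (coh_length coh).
have -> : j = k by lia.
rewrite /wedge subnn le_ki; move: le_ki; rewrite leq_eqVlt => /orP[/eqP<-|lt_ki].
  by rewrite leqnn !subnn.
by rewrite [(i <= k)%N]leqNgt lt_ki /= !lt0n (coh_length coh).
Qed.

Lemma wedgel k r d : wedge (k + r) (k + r + d) k = (r < lam d k)%N.
Proof. by rewrite /wedge leq_addr !addKn. Qed.

Lemma wedger k r d : wedge (k + r + d) (k + r) k = (r < mu d k)%N.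
Proof.
case: d => [|d]; first by rewrite addn0 /wedge leqnn subnn addKn (coh_first coh).
by rewrite /wedge addnS ltnNge leq_addr /= -addnS !addKn.
Qed.

(** Lowering one coordinate by 1 moves a point within one of the wedges or onto
    their common boundary.  In the coordinates of [wedgel] and [wedger] it
    changes [(d, k, r)] to [(d + 1, k, r - 1)], [(d - 1, k, r)] or
    [(d, k - 1, r + 1)], each of which is covered by one of the conditions of
    [coherent]. *)
Lemma member_down_step i j k : member i.+1 j k -> member i j k.
Proof.
have dropl := coh_dropl coh; have dropr := coh_dropr coh.
have strl := coh_strictl coh; have strr := coh_strictr coh.
have len := coh_length coh; rewrite /drop01 in dropl dropr.
case/or3P=> /and3P[le1 le2].
- have [le_ki|lt_ik] := leqP k i.
    rewrite member_wedge //; have [lt_ij|le_ji] := ltnP i j.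
      have -> : wedge i.+1 j k = wedge (k + (i - k).+1) (k + (i - k).+1 + (j - i.+1)) k.
        by congr wedge; lia.
      have -> : wedge i j k = wedge (k + (i - k)) (k + (i - k) + (j - i.+1).+1) k.
        by congr wedge; lia.
      by rewrite !wedgel; have := dropl (j - i.+1)%N k; lia.
    have -> : wedge i.+1 j k = wedge (k + (j - k) + (i - j).+1) (k + (j - k)) k.
      by congr wedge; lia.
    have -> : wedge i j k = wedge (k + (j - k) + (i - j)) (k + (j - k)) k.
      by congr wedge; lia.
    by rewrite !wedger; have := dropr (i - j)%N k; lia.
  rewrite member_cyc member_wedge; try lia.
  have -> : wedge i.+1 j k = wedge (i.+1 + 0) (i.+1 + 0 + (j - i.+1)) i.+1.
    by congr wedge; lia.
  have -> : wedge j k i = wedge (i + 1 + (j - i.+1)) (i + 1) i by congr wedge; lia.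
  rewrite wedger wedgel; have := strr (j - i.+1)%N i i.+1 (ltnSn i).
  by have := len (j - i.+1)%N i.+1; lia.
- rewrite member_cyc member_wedge; try lia.
  have [le_jk|lt_kj] := leqP j k.
    have -> : wedge j k i.+1 =
        wedge (i.+1 + (j - i.+1)) (i.+1 + (j - i.+1) + (k - j)) i.+1.
      by congr wedge; lia.
    have -> : wedge j k i = wedge (i + (j - i)) (i + (j - i) + (k - j)) i.
      by congr wedge; lia.
    by rewrite !wedgel; have := strl (k - j)%N i i.+1 (ltnSn i); lia.
  have -> : wedge j k i.+1 =
      wedge (i.+1 + (k - i.+1) + (j - k)) (i.+1 + (k - i.+1)) i.+1.
    by congr wedge; lia.
  have -> : wedge j k i = wedge (i + (k - i) + (j - k)) (i + (k - i)) i.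
    by congr wedge; lia.
  by rewrite !wedger; have := strr (j - k)%N i i.+1 (ltnSn i); lia.
have [le_ji|lt_ij] := leqP j i.
  rewrite -member_cyc member_wedge //; have [le_ki|lt_ik] := leqP k i.
    have -> : wedge k i.+1 j = wedge (j + (k - j)) (j + (k - j) + (i - k).+1) j.
      by congr wedge; lia.
    have -> : wedge k i j = wedge (j + (k - j)) (j + (k - j) + (i - k)) j.
      by congr wedge; lia.
    by rewrite !wedgel; have := dropl (i - k)%N j; lia.
  have -> : wedge k i.+1 j =
      wedge (j + (i - j).+1 + (k - i.+1)) (j + (i - j).+1) j.
    by congr wedge; lia.
  have -> : wedge k i j = wedge (j + (i - j) + (k - i.+1).+1) (j + (i - j)) j.
    by congr wedge; lia.
  by rewrite !wedger; have := dropr (k - i.+1)%N j; lia.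
rewrite member_cyc member_wedge; try lia.
have -> : wedge k i.+1 j = wedge (i.+1 + 0 + (k - i.+1)) (i.+1 + 0) i.+1.
  by congr wedge; lia.
have -> : wedge j k i = wedge (i + 1) (i + 1 + (k - i.+1)) i.
  by congr wedge; lia.
rewrite wedger wedgel; have := strl (k - i.+1)%N i i.+1 (ltnSn i).
by have := len (k - i.+1)%N i.+1; lia.
Qed.

Lemma member_down i j k i' j' k' : (i' <= i)%N -> (j' <= j)%N -> (k' <= k)%N ->
  member i j k -> member i' j' k'.
Proof.
have down1 a b c a' : (a' <= a)%N -> member a b c -> member a' b c.
  move=> /subnK <-; elim: (a - a')%N => // m IHm; rewrite addSn.
  by move/member_down_step.
move=> le_i le_j le_k /(down1 _ _ _ _ le_i); rewrite member_cyc.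
by move=> /(down1 _ _ _ _ le_j); rewrite member_cyc => /(down1 _ _ _ _ le_k);
  rewrite member_cyc.
Qed.

Definition solid : {set cube n} := 
  [set x : 'I_n * 'I_n * 'I_n | member x.1.1 x.1.2 x.2].

Lemma solid_cspp : solid \in cspp n.
Proof.
rewrite inE; apply/andP; split.
  apply/forallP => i; apply/forallP => j; apply/forallP => k.
  apply/forallP => i'; apply/forallP => j'; apply/forallP => k'.
  apply/implyP => /and4P[]; rewrite !inE /= => mem le_i le_j le_k.
  exact: member_down mem.
apply/forallP => i; apply/forallP => j; apply/forallP => k.
by apply/implyP; rewrite !inE /= member_cyc.
Qed.

End Member.

(** A row loses at most 1 at each of the [n - d] remaining steps, and the row of
    index [k] is at least [k] shorter than the first one.  Hence every point
    counted by a coherent family lies in the cube. *)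
Lemma row_bound (row : nat -> nat -> nat) d k r :
  (forall d k l, (k < l)%N -> row d l = 0%N \/ (row d l < row d k)%N) ->
  (forall d k, drop01 (row d k) (row d.+1 k)) -> (forall k, row n k = 0%N) ->
  (r < row d k)%N -> (k + r + d < n)%N.
Proof.
move=> strict drop last lt_r; rewrite /drop01 in drop.
have zero m l : row (n + m)%N l = 0%N.
  elim: m => [|m IHm]; first by rewrite addn0.
  by have := drop (n + m)%N l; rewrite addnS IHm; lia.
have le_d m l : (m <= n)%N -> (row (n - m)%N l <= m)%N.
  elim: m => [|m IHm] le_mn; first by rewrite subn0 last.
  have := drop (n - m.+1)%N l; have -> : (n - m.+1).+1 = (n - m)%N by lia.
  by have := IHm (ltnW le_mn); lia.
have row0 l s : (s < row d l)%N -> (s + l < row d 0)%N.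
  elim: l s => [|l IHl] s lt_s; first by rewrite addn0.
  by have := strict d l l.+1 (ltnSn l); have := IHl s.+1; lia.
have lt_dn : (d < n)%N.
  rewrite ltnNge; apply/negP => le_nd; have := zero (d - n)%N k.
  by rewrite subnKC // => row0'; rewrite row0' in lt_r.
have := le_d (n - d)%N 0%N; rewrite subKn; last exact: ltnW.
by have := row0 k r lt_r; lia.
Qed.

Lemma coh_lastr lam mu : coherent lam mu -> forall k, mu n k = 0%N.
Proof. by move=> coh k; apply/eqP; rewrite -(coh_length coh) (coh_last coh). Qed.

Lemma solid_inj lam mu lam' mu' : coherent lam mu -> coherent lam' mu' ->
  solid lam mu = solid lam' mu' -> lam =2 lam' /\ mu =2 mu'.
Proof.
move=> coh coh' eq_solid.
have eq_mem i j k : (i < n)%N -> (j < n)%N -> (k < n)%N ->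
    member lam mu i j k = member lam' mu' i j k.
  move=> lt_i lt_j lt_k.
  move/setP/(_ (Ordinal lt_i, Ordinal lt_j, Ordinal lt_k)): eq_solid.
  by rewrite !inE.
have eq_nat a b : (forall r, (r < a)%N = (r < b)%N) -> a = b.
  by move=> eq_ab; have := eq_ab a; have := eq_ab b; lia.
split=> d k; apply: eq_nat => r.
  have eq_in : (k + r + d < n)%N -> (r < lam d k)%N = (r < lam' d k)%N.
    move=> lt_n; have := eq_mem (k + r)%N (k + r + d)%N k.
    by rewrite !member_wedge ?wedgel //; try lia; apply; lia.
  apply/idP/idP => lt_r; first by rewrite -eq_in // (row_bound _ _ _ lt_r) //; case: coh.
  by rewrite eq_in // (row_bound _ _ _ lt_r) //; case: coh'.
have eq_in : (k + r + d < n)%N -> (r < mu d k)%N = (r < mu' d k)%N.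
  move=> lt_n; have le1 : (k <= k + r)%N := leq_addr _ _.
  have le2 : (k <= k + r + d)%N := leq_trans le1 (leq_addr _ _).
  rewrite -(wedger coh) -(wedger coh') -(member_wedge coh) // -(member_wedge coh') //.
  by apply: eq_mem; lia.
apply/idP/idP => lt_r.
  rewrite -eq_in //; apply: (row_bound _ _ _ lt_r); try by case: coh.
  exact: coh_lastr coh.
rewrite eq_in //; apply: (row_bound _ _ _ lt_r); try by case: coh'.
exact: coh_lastr coh'.
Qed.

(** * Diagonals of a cyclically symmetric plane partition *)

(** The length of an initial segment of the naturals given by its membership
    predicate. *)
Definition threshold (P : pred nat) := find (predC P) (iota 0 n).

Lemma thresholdP (P : pred nat) r :
  (forall s, P s.+1 -> P s) -> (forall s, P s -> (s < n)%N) ->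
  (r < threshold P)%N = P r.
Proof.
move=> down bnd; have le_t : (threshold P <= n)%N.
  by rewrite -[n in (_ <= n)%N](size_iota 0) find_size.
apply/idP/idP => [lt_r|Pr].
  have := before_find 0%N lt_r; rewrite nth_iota ?add0n; last exact: leq_trans lt_r le_t.
  by move/negbFE.
rewrite ltnNge; apply/negP => le_tr.
have lt_t : (threshold P < n)%N by rewrite (leq_ltn_trans le_tr) ?bnd.
have : ~~ P (threshold P).
  have := @nth_find _ 0%N (predC P) (iota 0 n); rewrite has_find size_iota => /(_ lt_t).
  by rewrite nth_iota.
move/negP; apply; move: Pr; rewrite -(subnK le_tr).
by elim: (r - _)%N => // m IHm; rewrite addSn => /down.
Qed.

Definition in_solid (pi : {set cube n}) i j k :=
  [exists x : 'I_n * 'I_n * 'I_n, (x \in pi) &&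
     [&& x.1.1 == i :> nat, x.1.2 == j :> nat & x.2 == k :> nat]].

Lemma in_solidE pi (i j k : 'I_n) : in_solid pi i j k = ((i, j, k) \in pi).
Proof.
apply/existsP/idP => [[[[i' j'] k'] /= /andP[pi_x] /and3P[]]|pi_x].
  by move=> /eqP/val_inj<- /eqP/val_inj<- /eqP/val_inj<-.
by exists (i, j, k); rewrite pi_x !eqxx.
Qed.

Section OfPartition.
Variable pi : {set cube n}.
Hypothesis pi_cspp : pi \in cspp n.

Lemma in_solid_bound i j k : in_solid pi i j k -> [/\ i < n, j < n & k < n]%N.
Proof. by case/existsP=> x /andP[_] /and3P[/eqP<- /eqP<- /eqP<-]; split; apply: ltn_ord. Qed.

Lemma in_solid_ord i j k : in_solid pi i j k ->
  exists i' j' k' : 'I_n, [/\ i = i', j = j', k = k' & (i', j', k') \in pi].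
Proof.
case/existsP=> -[[i' j'] k'] /andP[pi_x] /and3P[/eqP<- /eqP<- /eqP<-].
by exists i', j', k'.
Qed.

Lemma in_solid_down i j k i' j' k' : (i' <= i)%N -> (j' <= j)%N -> (k' <= k)%N ->
  in_solid pi i j k -> in_solid pi i' j' k'.
Proof.
move: pi_cspp; rewrite inE => /andP[down _] le_i le_j le_k.
case/in_solid_ord=> [a [b [c [ia jb kc pi_x]]]].
have lt_i : (i' < n)%N by rewrite (leq_ltn_trans le_i) ?ia.
have lt_j : (j' < n)%N by rewrite (leq_ltn_trans le_j) ?jb.
have lt_k : (k' < n)%N by rewrite (leq_ltn_trans le_k) ?kc.
rewrite (in_solidE pi (Ordinal lt_i) (Ordinal lt_j) (Ordinal lt_k)).
move/forallP/(_ a)/forallP/(_ b)/forallP/(_ c): down.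
move/forallP/(_ (Ordinal lt_i))/forallP/(_ (Ordinal lt_j))/forallP/(_ (Ordinal lt_k)).
by rewrite pi_x -ia -jb -kc le_i le_j le_k => /implyP; apply.
Qed.

Lemma in_solid_cyc i j k : in_solid pi i j k = in_solid pi j k i.
Proof.
have cyc a b c : in_solid pi a b c -> in_solid pi b c a.
  case/in_solid_ord=> [a' [b' [c' [-> -> -> pi_x]]]]; rewrite in_solidE.
  move: pi_cspp; rewrite inE => /andP[_].
  by move/forallP/(_ a')/forallP/(_ b')/forallP/(_ c')/implyP; apply.
by apply/idP/idP => [/cyc|/cyc/cyc].
Qed.

Definition rowl d k := threshold (fun r => in_solid pi (k + r) (k + r + d) k).
Definition rowr d k := threshold (fun r => in_solid pi (k + r + d) (k + r) k).

Lemma rowlP d k r : (r < rowl d k)%N = in_solid pi (k + r) (k + r + d) k.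
Proof.
apply: thresholdP => s; last by case/in_solid_bound; lia.
by apply: in_solid_down; lia.
Qed.

Lemma rowrP d k r : (r < rowr d k)%N = in_solid pi (k + r + d) (k + r) k.
Proof.
apply: thresholdP => s; last by case/in_solid_bound; lia.
by apply: in_solid_down; lia.
Qed.

Lemma rows_coherent : coherent rowl rowr.
Proof.
have pos a : (forall r, (r < a)%N -> False) -> a = 0%N.
  by case: a => // a /(_ a (ltnSn a)).
have drop a b : (forall r, (r < b)%N -> (r < a)%N) ->
    (forall r, (r.+1 < a)%N -> (r < b)%N) -> drop01 a b.
  move=> le_ba le_ab; rewrite /drop01; have := le_ba a; have := le_ab b.
  by have := le_ba b.-1; have := le_ab a.-2; lia.
split.
- move=> d k l lt_kl; case E: (rowl d l) => [|t]; [by left | right].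
  have := rowlP d l t; rewrite E ltnSn rowlP => /esym.
  by apply: in_solid_down; lia.
- move=> d k l lt_kl; case E: (rowr d l) => [|t]; [by left | right].
  have := rowrP d l t; rewrite E ltnSn rowrP => /esym.
  by apply: in_solid_down; lia.
- move=> d k; apply: drop => r; rewrite !rowlP => in_r.
    by apply: in_solid_down in_r; lia.
  by apply: in_solid_down in_r; lia.
- move=> d k; apply: drop => r; rewrite !rowrP => in_r.
    by apply: in_solid_down in_r; lia.
  by apply: in_solid_down in_r; lia.
- move=> d k; apply: negb_inj; rewrite -!lt0n rowlP rowrP !addn0.
  by rewrite in_solid_cyc.
- by move=> k; apply: pos => r; rewrite rowlP => /in_solid_bound[]; lia.
by move=> k; apply: eq_find => r; rewrite /= addn0.
Qed.

Lemma solid_rows : solid rowl rowr = pi.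
Proof.
apply/setP => -[[i j] k]; rewrite inE /= -in_solidE.
have wedgeE a b c : (c <= a)%N -> (c <= b)%N ->
    member rowl rowr a b c = in_solid pi a b c.
  move=> le_ca le_cb; rewrite (member_wedge rows_coherent) // /wedge.
  by case: (leqP a b) => le_ab; rewrite ?rowlP ?rowrP; congr (in_solid _ _ _ _); lia.
have [le_ki|lt_ik] := leqP k i.
  have [le_kj|lt_jk] := leqP k j; first exact: wedgeE.
  by rewrite -(member_cyc _ _ k i j) wedgeE ?(in_solid_cyc k i j) //; lia.
have [le_ij|lt_ji] := leqP i j.
  by rewrite (member_cyc _ _ i j k) wedgeE ?(in_solid_cyc i j k) //; lia.
by rewrite -(member_cyc _ _ k i j) wedgeE ?(in_solid_cyc k i j) //; lia.
Qed.

End OfPartition.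
End RowData.

(** * Partitions as closed chains *)

Section ChainsOfPartitions.
Variable n : nat.
Local Notation state := {ffun 'I_n -> 'I_n.+1}.
Local Notation empty2 := (empty_state n, empty_state n).

(** Reading a state at any natural number, with 0 beyond [n]. *)
Definition part (f : state) k : nat := if insub k is Some i then f i else 0.

Lemma partE f (i : 'I_n) : part f i = f i.
Proof. by rewrite /part valK. Qed.

Lemma part_out f k : (n <= k)%N -> part f k = 0%N.
Proof. by move=> le_nk; rewrite /part insubF // ltnNge le_nk. Qed.

Lemma part_inj f g : part f =1 part g -> f = g.
Proof. by move=> eq_fg; apply/ffunP => i; apply: val_inj; rewrite /= -!partE. Qed.

Lemma part_empty k : part (empty_state n) k = 0%N.
Proof. by rewrite /part; case: insubP => // i _ _; rewrite ffunE. Qed.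

Lemma part_strict f k l : strict_part f -> (k < l)%N ->
  part f l = 0%N \/ (part f l < part f k)%N.
Proof.
move=> /strict_partP sf lt_kl; have [le_nl|lt_ln] := leqP n l.
  by left; rewrite part_out.
have lt_kn := ltn_trans lt_kl lt_ln.
have := sf (Ordinal lt_kn) (Ordinal lt_ln) lt_kl.
by rewrite -!partE.
Qed.

Lemma part_erode f g k : erode f g -> drop01 (part f k) (part g k).
Proof.
move=> /forallP ef; have [le_nk|lt_kn] := leqP n k; first by rewrite !part_out.
by have := ef (Ordinal lt_kn); rewrite -!partE.
Qed.

Lemma part_length f g k : same_length f g -> (part f k == 0%N) = (part g k == 0%N).
Proof.
move=> /forallP len; have [le_nk|lt_kn] := leqP n k; first by rewrite !part_out.
by have /eqP := len (Ordinal lt_kn); rewrite -!partE.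
Qed.

(** A partition corresponds to a chain of pairs starting from a diagonal pair
    [(f, f)], since both families of diagonals start at [d = 0]. *)
Definition closed_chains : {set state * n.-tuple (state * state)} :=
  [set p : state * n.-tuple (state * state) |
     strict_part p.1 && (p.2 \in chains n (p.1, p.1))].

Lemma card_closed_chains :
  #|closed_chains| = (\sum_(f : state | strict_part f) #|chains n (f, f)|)%N.
Proof.
rewrite /closed_chains -sum1dep_card.
rewrite -(pair_big_dep (fun f : state => strict_part f)
  (fun f (t : n.-tuple (state * state)) => t \in chains n (f, f)) (fun _ _ => 1%N)) /=.
by apply: eq_bigr => f _; rewrite sum1_card.
Qed.

(** Beyond the end of the chain the slices are empty, by the default value. *)
Definition slice (p : state * n.-tuple (state * state)) d :=
  nth empty2 ((p.1, p.1) :: p.2) d.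

Definition rows1 p d k := part (slice p d).1 k.
Definition rows2 p d k := part (slice p d).2 k.

Lemma slices_eq p q : slice p =1 slice q -> p = q.
Proof.
case: p q => [f t] [g u] eq_pq.
have /= [-> _] := eq_pq 0%N; congr pair; apply: val_inj.
apply: (@eq_from_nth _ empty2); first by rewrite !size_tuple.
by move=> i _; have := eq_pq i.+1.
Qed.

Lemma empty_strict : strict_part (empty_state n).
Proof. by apply/strict_partP => i j _; left; rewrite ffunE. Qed.

Lemma closed_chain_coherent p : p \in closed_chains -> coherent n (rows1 p) (rows2 p).
Proof.
case: p => [f t]; rewrite !inE /= => /and3P[sf /(pathP empty2) st /eqP last_t].
have slice_out d : (n <= d)%N -> slice (f, t) d = empty2.
  rewrite leq_eqVlt => /orP[/eqP<-|lt_nd]; last first.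
    by rewrite /slice nth_default //= size_tuple.
  rewrite -last_t (last_nth empty2) size_tuple //.
have step d : (d < n)%N -> chain_step (slice (f, t) d) (slice (f, t) d.+1).
  by move=> lt_d; apply: st; rewrite size_tuple.
have good d : [/\ strict_part (slice (f, t) d).1, strict_part (slice (f, t) d).2
    & same_length (slice (f, t) d).1 (slice (f, t) d).2].
  have [le_nd|lt_dn] := leqP n d.
    rewrite slice_out //=; split; try exact: empty_strict.
    by apply/forallP => i; rewrite eqxx.
  case: d lt_dn => [|d] lt_dn.
    by split=> //; apply/forallP => i; rewrite eqxx.
  by have /and5P[] := step d (ltnW lt_dn).
have er d : erode (slice (f, t) d).1 (slice (f, t) d.+1).1 /\
    erode (slice (f, t) d).2 (slice (f, t) d.+1).2.
  have [le_nd|lt_dn] := leqP n d; last by have /and5P[] := step d lt_dn.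
  rewrite !slice_out //; last exact: leqW.
  by split; apply/forallP => i; rewrite /drop01 eqxx.
split.
- by move=> d k l; case: (good d) => s1 s2 len; apply: part_strict.
- by move=> d k l; case: (good d) => s1 s2 len; apply: part_strict.
- by move=> d k; case: (er d) => e1 e2; apply: part_erode.
- by move=> d k; case: (er d) => e1 e2; apply: part_erode.
- by move=> d k; case: (good d) => s1 s2 len; apply: part_length.
- by move=> k; rewrite /rows1 slice_out //= part_empty.
by [].
Qed.

Lemma solid_rows_inj :
  {in closed_chains &, injective (fun p => solid n (rows1 p) (rows2 p))}.
Proof.
move=> p q /closed_chain_coherent coh_p /closed_chain_coherent coh_q eq_pq.
have [eq1 eq2] := solid_inj coh_p coh_q eq_pq.
apply: slices_eq => d; rewrite [LHS]surjective_pairing [RHS]surjective_pairing.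
by congr pair; apply: part_inj => k; [apply: eq1 | apply: eq2].
Qed.

(** The chain of a partition is read off its diagonals, [rowl] and [rowr]. *)
Lemma cspp_chain pi : pi \in cspp n ->
  exists2 p, p \in closed_chains & solid n (rows1 p) (rows2 p) = pi.
Proof.
move=> pi_cspp; have coh := rows_coherent pi_cspp.
pose mk (row : nat -> nat) : state := [ffun k : 'I_n => inord (row k)].
have part_mk (row : nat -> nat) k : (forall k, (row k <= n)%N) ->
    (forall k, (n <= k)%N -> row k = 0%N) -> part (mk row) k = row k.
  move=> le_row row_out; have [le_nk|lt_kn] := leqP n k; first by rewrite part_out ?row_out.
  by rewrite -[k]/(val (Ordinal lt_kn)) partE ffunE inordK ?ltnS.
have mkE (row : nat -> nat) (k : 'I_n) : (row k <= n)%N -> mk row k = row k :> nat.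
  by move=> le_row; rewrite ffunE inordK ?ltnS.
have le_l d k : (rowl pi d k <= n)%N.
  by rewrite -[n in (_ <= n)%N](size_iota 0) find_size.
have le_r d k : (rowr pi d k <= n)%N.
  by rewrite -[n in (_ <= n)%N](size_iota 0) find_size.
pose st d := (mk (rowl pi d), mk (rowr pi d)).
have st0 : st 0 = (mk (rowl pi 0), mk (rowl pi 0)).
  by congr pair; apply/ffunP => k; rewrite !ffunE (coh_first coh).
pose p := (mk (rowl pi 0), [tuple st d.+1 | d < n]).
have sliceE d : (d <= n)%N -> slice p d = st d.
  case: d => [|d] le_dn; first by rewrite st0.
  rewrite /slice /= -[d]/(val (Ordinal le_dn)) nth_mktuple //.
have strictl d : strict_part (mk (rowl pi d)).
  by apply/strict_partP => i j lt_ij; rewrite !mkE //; apply: (coh_strictl coh).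
have strictr d : strict_part (mk (rowr pi d)).
  by apply/strict_partP => i j lt_ij; rewrite !mkE //; apply: (coh_strictr coh).
have step d : chain_step (st d) (st d.+1).
  apply/and5P; split; [|exact: strictl| |exact: strictr|];
    apply/forallP => k; rewrite /= !mkE //.
  - exact: (coh_dropl coh).
  - exact: (coh_dropr coh).
  by apply/eqP; apply: (coh_length coh).
have out_l d k : (n <= d)%N || (n <= k)%N -> rowl pi d k = 0%N.
  move=> out; case E: (rowl pi d k) => [|r] //.
  have := rowlP pi_cspp d k r; rewrite E ltnSn => /esym/in_solid_bound[]; lia.
have out_r d k : (n <= d)%N || (n <= k)%N -> rowr pi d k = 0%N.
  by move=> /out_l/eqP; rewrite (coh_length coh) => /eqP.
have stE d : st d = empty2 \/ (d < n)%N.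
  have [le_nd|] := leqP n d; [left | by right].
  by congr pair; apply: part_inj => k; rewrite part_empty part_mk // => *;
    rewrite ?out_l ?out_r ?le_nd.
have p_closed : p \in closed_chains.
  rewrite inE; apply/andP; split; first exact: strictl.
  rewrite inE; apply/andP; split.
    apply/(pathP empty2) => i; rewrite size_tuple => lt_in.
    rewrite -[X in chain_step X _]/(slice p i) -[X in chain_step _ X]/(slice p i.+1).
    by rewrite !sliceE // ltnW.
  rewrite (last_nth empty2) size_tuple -[nth _ _ _]/(slice p n) sliceE //.
  by case: (stE n) => [->//|]; rewrite ltnn.
exists p => //; rewrite -[RHS](solid_rows pi_cspp).
have rows_eq d : rows1 p d =1 rowl pi d /\ rows2 p d =1 rowr pi d.
  have [le_dn|lt_nd] := leqP d n.
    rewrite /rows1 /rows2 sliceE //; split=> k; rewrite part_mk // => *.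
      by rewrite out_l ?orbT //; apply/orP; right.
    by rewrite out_r ?orbT //; apply/orP; right.
  have sz : size ((p.1, p.1) :: p.2) = n.+1 := congr1 succn (size_tuple p.2).
  have slice_p : slice p d = empty2 by rewrite /slice nth_default // sz.
  rewrite /rows1 /rows2 slice_p.
  by split=> k; rewrite part_empty ?out_l ?out_r ?(ltnW lt_nd).
by congr solid; apply/funext => d; apply/funext => k; case: (rows_eq d).
Qed.

Lemma card_cspp :
  #|cspp n| = (\sum_(f : state | strict_part f) #|chains n (f, f)|)%N.
Proof.
rewrite -card_closed_chains -(card_in_imset solid_rows_inj); congr #|pred_of_set _|.
apply/setP => pi; apply/idP/imsetP => [/cspp_chain[p pC <-]|[p pC ->]].
  by exists p.
by apply: solid_cspp; apply: closed_chain_coherent.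
Qed.

End ChainsOfPartitions.

(** * The enumeration *)

Theorem theorem5p3 (n : nat) :
  #|cspp n|%:R = 3 ^- 'C(n, 2) * hankel n hatC1 :> rat.
Proof.
rewrite -hankel_hatC1 -det_gram_pascal -sum_link_strict card_cspp natr_sum.
apply: eq_bigr => f sf; apply: card_chains => //.
by apply/forallP => i; rewrite eqxx.
Qed.
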